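(* Let $\mathbb{L}$ be an $F$-finite field of characteristic $p>0$, let $\mathscr{M}=\{\boldsymbol{x}^{\boldsymbol{a}_1},\dots,\boldsymbol{x}^{\boldsymbol{a}_n}\}$ be a collection of $n$ distinct monomials in $x_1,\dots,x_m$ with all $\boldsymbol{a}_i\in\mathbb{N}^m$ non-zero, and let $f\in\mathbb{L}[x_1,\dots,x_m]$ be a polynomial with $\operatorname{Supp}(f)=\mathscr{M}$. Let $\boldsymbol{P}$ be the splitting polytope and $\boldsymbol{N}$ the Newton polyhedron of $\mathscr{M}$. Suppose that $\boldsymbol{P}$ contains a unique maximal point $\boldsymbol{\eta}=(\eta_1,\dots,\eta_n)$, and let $$L=\sup\{e\ge 0 : \eta_1^{(d)}+\cdots+\eta_n^{(d)}\le p-1 \text{ for all } 0\le d\le e\},$$ where $\eta_i^{(d)}$ is the $d$-th digit of $\eta_i$ in base $p$. (1) If $L=\infty$, then $\operatorname{fpt}_{\mathfrak{m}}(f)=\operatorname{fpt}_{\mathfrak{m}}(\mathscr{M})$. The converse holds if $\boldsymbol{N}$ is in diagonal position and $p$ does not divide any of the denominators of the (rational) entries of $\boldsymbol{\eta}$. (2) If $L<\infty$, then $\operatorname{fpt}_{\mathfrak{m}}(f)\ge \langle\eta_1\rangle_L+\cdots+\langle\eta_n\rangle_L+\frac{1}{p^L}$.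
   Context: $\mathbb{N}$ contains $0$. A field $\mathbb{L}$ of characteristic $p>0$ is $F$-finite if $[\mathbb{L}:\mathbb{L}^p]<\infty$. $\operatorname{Supp}(f)$ is the set of monomials occurring in $f$ with non-zero coefficient. $F$-pure thresholds: in $R=\mathbb{L}[x_1,\dots,x_m]$ let $\mathfrak{m}=(x_1,\dots,x_m)$ and $\mathfrak{m}^{[p^e]}=(x_1^{p^e},\dots,x_m^{p^e})$. For a non-zero ideal $\mathfrak{a}\subseteq\mathfrak{m}$ let $\nu_{\mathfrak{a}}(p^e)=\max\{r:\mathfrak{a}^r\not\subseteq\mathfrak{m}^{[p^e]}\}$ and $\operatorname{fpt}_{\mathfrak{m}}(\mathfrak{a})=\lim_{e\to\infty}\nu_{\mathfrak{a}}(p^e)/p^e$ (the limit exists). For $0\ne f\in\mathfrak{m}$, $\operatorname{fpt}_{\mathfrak{m}}(f)$ is that of the ideal $(f)$; $\operatorname{fpt}_{\mathfrak{m}}(\mathscr{M})$ is that of the ideal generated by $\mathscr{M}$. Digits: each $\alpha\in(0,1]$ has a unique non-terminating base $p$ expansion $\alpha=\sum_{e\ge1}\alpha^{(e)}/p^e$ with integers $0\le\alpha^{(e)}\le p-1$ not eventually all zero; $\alpha^{(e)}$ is the $e$-th digit. Conventions: $\alpha^{(0)}=0$, $0^{(e)}=0$. The truncation is $\langle\alpha\rangle_d=\sum_{e=1}^d\alpha^{(e)}/p^e$ (so $\langle\alpha\rangle_0=0$ and $\langle 0\rangle_d=0$). Polytopes: $|\boldsymbol{s}|=s_1+\cdots+s_n$;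 $\preccurlyeq$ is component-wise $\le$; $\mathbf{1}_m=(1,\dots,1)\in\mathbb{R}^m$. $\mathbf{E}$ is the $m\times n$ matrix with columns $\boldsymbol{a}_1,\dots,\boldsymbol{a}_n$. The splitting polytope is $\boldsymbol{P}=\{\boldsymbol{s}\in\mathbb{R}^n_{\ge0}:\mathbf{E}\boldsymbol{s}\preccurlyeq\mathbf{1}_m\}\subseteq[0,1]^n$. A maximal point of $\boldsymbol{P}$ is a point of $\boldsymbol{P}$ at which $|\cdot|$ attains its maximum $\alpha$ on $\boldsymbol{P}$. If the maximal point is unique, its entries are rational. Newton polyhedron: $\boldsymbol{N}=\operatorname{conv}\{\boldsymbol{a}_1,\dots,\boldsymbol{a}_n\}+\mathbb{R}^m_{\ge0}$. A face of $\boldsymbol{N}$ is a non-empty set $\ell^{-1}(\beta)\cap\boldsymbol{N}$ with $\ell$ a non-zero linear form, $\beta\in\mathbb{R}$ and $\ell\ge\beta$ on $\boldsymbol{N}$. The point $\frac1\alpha\mathbf{1}_m$ lies on the boundary of $\boldsymbol{N}$; let $\boldsymbol{\Lambda}$ be the unique minimal face (under inclusion) containing it. $\boldsymbol{N}$ is in diagonal position if $\boldsymbol{\Lambda}$ is bounded. *)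

(* Defs.v *)
From HB Require Import structures.
From mathcomp Require Import all_boot all_order all_algebra.
From mathcomp Require Import all_classical all_reals all_analysis.
(* The notations of mpoly clash with those of MathComp-Analysis, hence the
   restricted import. Thus {mpoly K[m]} is written mpoly.mpoly m K, and
   'X_{1..m} is written mpoly.multinom m. *)
From mathcomp Require mpoly.
Import (canonicals, coercions) mpoly.
Set Implicit Arguments.
Unset Strict Implicit.
Unset Printing Implicit Defensive.
Import Order.TTheory GRing.Theory Num.Theory.
Import numFieldNormedType.Exports.
Local Open Scope classical_set_scope.
Local Open Scope ring_scope.

(* [K : K^p] < oo, stated as: K is spanned by finitely many elements over its
   subfield of p-th powers. *)
Definition F_finite (p : nat) (K : fieldType) : Prop :=
  exists (k : nat) (b : 'I_k -> K),
    forall x : K, exists c : 'I_k -> K, x = \sum_(i < k) c i ^+ p * b i.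

Definition ideal_gen (A : comNzRingType) (S : set A) : set A :=
  [set x | exists (k : nat) (c g : 'I_k -> A),
     (forall i, S (g i)) /\ x = \sum_(i < k) c i * g i].

(* For r = 0 the only product is 1, so that the power is the whole ring. *)
Definition ideal_pow (A : comNzRingType) (I : set A) (r : nat) : set A :=
  ideal_gen [set x | exists g : 'I_r -> A,
     (forall i, I (g i)) /\ x = \prod_(i < r) g i].

Definition frobenius_max_ideal (K : fieldType) (m q : nat) :
    set (mpoly.mpoly m K) :=
  ideal_gen [set mpoly.mpolyX K (mpoly.mnm1 i) ^+ q | i in [set: 'I_m]].

Arguments frobenius_max_ideal K m q _ : clear implicits.

Definition fpt_nu (K : fieldType) (m : nat) (I : set (mpoly.mpoly m K))
    (q : nat) : nat :=
  xget 0%N [set r | ~ (ideal_pow I r `<=` frobenius_max_ideal K m q) /\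
    forall s, ~ (ideal_pow I s `<=` frobenius_max_ideal K m q) -> (s <= r)%N].

(* p is meant to be the characteristic of K. *)
Definition fpt (R : realType) (p : nat) (K : fieldType) (m : nat)
    (I : set (mpoly.mpoly m K)) : R :=
  limn (fun e : nat => (fpt_nu I (p ^ e))%:R / (p ^ e)%:R : R).

Definition fpt_poly (R : realType) (p : nat) (K : fieldType) (m : nat)
    (f : mpoly.mpoly m K) : R :=
  fpt R p (ideal_gen [set f]).

Definition fpt_monomials (R : realType) (p : nat) (K : fieldType) (m n : nat)
    (a : 'I_n -> mpoly.multinom m) : R :=
  fpt R p (ideal_gen [set mpoly.mpolyX K (a j) | j in [set: 'I_n]]).

Definition digit_sum (R : realType) (p : nat) (d : nat -> nat) (N : nat) : R :=
  \sum_(1 <= e < N.+1) (d e)%:R / p%:R ^+ e.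

Definition nonterminating_expansion (R : realType) (p : nat) (x : R)
    (d : nat -> nat) : Prop :=
  [/\ d 0%N = 0%N,
      (forall e, d e <= p.-1)%N,
      ~ (exists N : nat, forall e, (N <= e)%N -> d e = 0%N) &
      digit_sum R p d @ \oo --> x].

(* The expansion of x in ]0, 1]. The number 0 has no non-terminating expansion,
   so the default value of xget provides the convention that its digits
   are 0. *)
Definition digit (R : realType) (p : nat) (x : R) : nat -> nat :=
  xget (fun=> 0%N) [set d | nonterminating_expansion p x d].

Definition truncation (R : realType) (p : nat) (x : R) (d : nat) : R :=
  digit_sum R p (digit p x) d.

Definition coord_sum (R : realType) (n : nat) (s : 'cV[R]_n) : R :=
  \sum_(j < n) s j 0.

Definition exponent_matrix (R : realType) (m n : nat)
    (a : 'I_n -> mpoly.multinom m) : 'M[R]_(m, n) :=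
  \matrix_(i < m, j < n) (a j i)%:R.

Definition splitting_polytope (R : realType) (m n : nat)
    (a : 'I_n -> mpoly.multinom m) : set 'cV[R]_n :=
  [set s : 'cV[R]_n | (forall j, 0 <= s j 0) /\
           (forall i, (exponent_matrix R a *m s) i 0 <= 1)].

Arguments splitting_polytope R {m n} a _.

Definition maximal_point (R : realType) (n : nat) (P : set 'cV[R]_n)
    (s : 'cV[R]_n) : Prop :=
  P s /\ forall t, P t -> coord_sum t <= coord_sum s.

Definition polytope_max (R : realType) (m n : nat)
    (a : 'I_n -> mpoly.multinom m) : R :=
  sup [set coord_sum s | s in splitting_polytope R a].

Definition newton_polyhedron (R : realType) (m n : nat)
    (a : 'I_n -> mpoly.multinom m) : set 'cV[R]_m :=
  [set v : 'cV[R]_m | exists (w : 'cV[R]_n) (u : 'cV[R]_m),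
     [/\ (forall j, 0 <= w j 0), coord_sum w = 1, (forall i, 0 <= u i 0) &
         v = exponent_matrix R a *m w + u]].

Arguments newton_polyhedron R {m n} a _.

Definition is_face (R : realType) (m : nat) (N F : set 'cV[R]_m) : Prop :=
  F !=set0 /\
  exists (l : {scalar 'cV[R]_m}) (b : R),
    [/\ (exists v, l v != 0), (forall v, N v -> b <= l v) &
        F = [set v | l v = b] `&` N].

Definition minimal_face_at (R : realType) (m : nat) (N : set 'cV[R]_m)
    (x : 'cV[R]_m) (F : set 'cV[R]_m) : Prop :=
  [/\ is_face N F, F x &
      forall G, is_face N G -> G x -> G `<=` F -> G = F].

Definition diagonal_position (R : realType) (m n : nat)
    (a : 'I_n -> mpoly.multinom m) : Prop :=
  exists F : set 'cV[R]_m,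
    minimal_face_at (newton_polyhedron R a) (const_mx (polytope_max R a)^-1) F
    /\ bounded_set F.

Definition carry_free_upto (R : realType) (p n : nat) (s : 'cV[R]_n)
    (e : nat) : Prop :=
  forall d, (d <= e)%N -> (\sum_(j < n) digit p (s j 0%R) d <= p.-1)%N.

Definition carry_free_length (R : realType) (p n : nat) (s : 'cV[R]_n) :
    \bar R :=
  ereal_sup [set (e%:R : R)%:E | e in [set e : nat | carry_free_upto p s e]].

(* Main.v *)
(** Let q be a power of p. A power f^r lies outside m^[q] iff it contains a
    monomial x^u with all u_i < q. Expanding, u = E k with |k| = r, so that the
    point k / q lies in the splitting polytope P. If k <= q eta, then E k is
    reached from no other k' with |k'| = r, since eta + (k' - k) / q would be a
    second maximal point of P; hence x^(E k) occurs in f^r iff p does not divide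
    the multinomial coefficient of k, iff the base p digits of the k_i add
    without carrying (Kummer). Truncating the expansions of eta, or modifying
    them just after the first carry, yields the lower bounds on fpt(f), while
    fpt(M) = |eta|. Conversely let fpt(f) = |eta| and let (q - 1) eta be
    integral, which holds for arbitrarily large q: eta is rational, being a
    vertex of P, with denominators prime to p. Since fpt(f) <= (nu_f(q) + 1) /
    q, the power f^((q-1)|eta|) lies outside m^[q], so it contains some x^(E k)
    with E k <= q - 1 and k free of carries; then k / (q - 1) is a maximal point
    of P, so that k = (q - 1) eta, whose digits are the first digits of eta. *)
Require Import Defs.
From HB Require Import structures.
From mathcomp Require Import all_boot all_order all_algebra cyclic.
From mathcomp Require Import zify ring lra boolp.
From mathcomp Require mpoly.
Import (canonicals, coercions) mpoly.
Set Implicit Arguments.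
Unset Strict Implicit.
Unset Printing Implicit Defensive.
Import Order.TTheory GRing.Theory Num.Theory.

(** * Carries in base p *)

(** The quotient of this sum by [p ^ t] is the carry into position t when the [k j] are added in
    base p. *)
Definition no_carry (p n : nat) (k : 'I_n -> nat) : Prop :=
  forall t, \sum_(j < n) k j %% p ^ t < p ^ t.

Lemma no_carry0 p n : 0 < p -> no_carry p (fun=> 0 : nat) (n := n).
Proof.
by move=> p0 t; rewrite big1 ?expn_gt0 ?p0// => j _; rewrite mod0n.
Qed.

Lemma modn_digit p k c t : c < p ->
  (p * k + c) %% p ^ t.+1 = p * (k %% p ^ t) + c.
Proof.
move=> cp; have p0 : 0 < p by exact: leq_ltn_trans cp.
rewrite {1}(divn_eq k (p ^ t)) mulnDr -addnA [p * (_ * _)]mulnCA -expnS.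
rewrite modnMDl modn_small// expnS.
apply: (@leq_trans (p * (k %% p ^ t).+1)); first by rewrite mulnS addnC ltn_add2r.
by rewrite leq_pmul2l// ltn_mod expn_gt0 p0.
Qed.

(** The induction step for numbers built digit by digit: modulo [p ^ t.+1] the sum is p times the
    one for [k] modulo [p ^ t], plus the sum of the [c j]. *)
Lemma no_carry_digit p n (k c : 'I_n -> nat) : (forall j, c j < p) -> 0 < p ->
  no_carry p (fun j => p * k j + c j) <-> no_carry p k /\ \sum_(j < n) c j < p.
Proof.
move=> cp p0.
have E t : \sum_(j < n) (p * k j + c j) %% p ^ t.+1 =
    p * (\sum_(j < n) k j %% p ^ t) + \sum_(j < n) c j.
  by rewrite big_distrr -big_split; apply: eq_bigr => j _; exact: modn_digit.
split=> [H|[Hk Hc] [|t]].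
- split; last first.
    have := H 1; rewrite E expn1; apply: leq_ltn_trans; exact: leq_addl.
  move=> t; have := H t.+1; rewrite E expnS.
  move/(leq_ltn_trans (leq_addr _ _)); by rewrite ltn_pmul2l.
- by rewrite big1// => j _; rewrite modn1.
- rewrite E expnS; apply: (@leq_trans (p * (\sum_(j < n) k j %% p ^ t).+1)).
    by rewrite mulnS addnC ltn_add2r.
  by rewrite leq_pmul2l.
Qed.

Lemma eq_no_carry p n (k k' : 'I_n -> nat) : k =1 k' -> no_carry p k -> no_carry p k'.
Proof. by move=> e H t; rewrite -(eq_bigr _ (fun j _ => congr1 (modn^~ _) (e j))). Qed.

(** The common bound [B] lets Legendre's formulas for several factorials be added term by term. *)
Lemma logn_fact_le p n B : prime p -> n <= B ->
  logn p n`! = \sum_(1 <= t < B.+1) n %/ p ^ t.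
Proof.
move=> pp nB; rewrite logn_fact// [RHS](big_cat_nat (n := n.+1))//=.
rewrite [X in _ + X]big_nat_cond [X in _ + X]big1 ?addn0// => t.
rewrite andbT => /andP[nt _]; apply: divn_small.
by apply: leq_trans (ltn_expl _ (prime_gt1 pp)) _; rewrite leq_exp2l ?prime_gt1// ltnW.
Qed.

Lemma logn_prod p n (F : 'I_n -> nat) : (forall j, 0 < F j) ->
  logn p (\prod_(j < n) F j) = \sum_(j < n) logn p (F j).
Proof.
move=> F0; suff: 0 < \prod_(j < n) F j /\
    logn p (\prod_(j < n) F j) = \sum_(j < n) logn p (F j) by case.
elim/big_ind2 : _ => [|_ x _ y [x0 <-] [y0 <-]|//]; first by rewrite logn1.
by rewrite muln_gt0 x0 y0 lognM.
Qed.

(* Kummer's theorem for multinomial coefficients, from Legendre's formula *)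
Lemma multinomial_ndvd p n (k : 'I_n -> nat) M : prime p ->
  M * \prod_(j < n) (k j)`! = (\sum_(j < n) k j)`! -> ~~ (p %| M) <-> no_carry p k.
Proof.
move=> pp eM; set S := \sum_(j < n) k j in eM.
have pt t : 0 < p ^ t by rewrite expn_gt0 prime_gt0.
have M0 : 0 < M by rewrite lt0n; apply/eqP => M0; move: (fact_gt0 S); rewrite -eM M0.
have P0 : 0 < \prod_(j < n) (k j)`! by apply: prodn_gt0 => j; exact: fact_gt0.
have kS j : k j <= S by rewrite /S (bigD1 j)//= leq_addr.
(* Each term is the carry into position t, so the valuation is the sum of all carries. *)
have lM : logn p M = \sum_(1 <= t < S.+1) (\sum_(j < n) k j %% p ^ t) %/ p ^ t.
  apply/eqP; rewrite -(eqn_add2r (logn p (\prod_(j < n) (k j)`!))).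
  rewrite -lognM// eM (logn_fact_le pp (leqnn S)) logn_prod; last first.
    by move=> j; exact: fact_gt0.
  rewrite (eq_bigr _ (fun j _ => logn_fact_le pp (kS j))) exchange_big -big_split.
  apply/eqP; apply: eq_bigr => t _ /=.
  rewrite {1}/S (eq_bigr _ (fun j _ => divn_eq (k j) (p ^ t))) big_split /=.
  by rewrite -big_distrl /= divnMDl// addnC.
have -> : ~~ (p %| M) = (logn p M == 0).
  by rewrite -leqn0 leqNgt logn_gt0 mem_primes pp M0.
rewrite lM sum_nat_seq_eq0; split=> [/allP H t|H]; last first.
  by apply/allP => t _ /=; rewrite divn_small.
have [->|t0] := posnP t; first by rewrite big1// => j _; rewrite modn1.
have [tS|St] := ltnP t S.+1.
  move: (H t); rewrite mem_index_iota t0 tS => /(_ isT)/=.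
  by rewrite -leqn0 leqNgt divn_gt0// -ltnNge.
(* For t > S the residues add up to at most S, which is below [p ^ t]. *)
apply: (@leq_ltn_trans S); first by apply: leq_sum => j _; exact: leq_mod.
by apply: (ltn_trans (ltn_expl S (prime_gt1 pp))); rewrite ltn_exp2l ?prime_gt1.
Qed.

(** * Powers of polynomials and Frobenius powers *)

Module Polynomials.
Import mpoly.
Local Open Scope ring_scope.

Lemma mderiv_sumX_exp n r (i : 'I_n) :
  ((\sum_(j < n) 'X_j : {mpoly int[n]}) ^+ r.+1)^`M(i) =
  (\sum_(j < n) 'X_j) ^+ r *+ r.+1.
Proof.
set S := \sum_(j < n) 'X_j.
have dS : S^`M(i) = 1 :> {mpoly int[n]}.
  rewrite /S raddf_sum /= (bigD1 i)//= mderivX mnm1E eqxx scale1r.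
  have -> : (U_(i) - U_(i) = 0)%MM by apply/mnmP => l; rewrite mnmBE subnn mnm0E.
  rewrite mpolyX0 big1 ?addr0// => j ji.
  by rewrite mderivX mnm1E (negPf ji) scale0r.
elim: r => [|r IH]; first by rewrite expr1 expr0.
by rewrite exprS mderivM dS mul1r IH mulrnAr -exprS -mulrS.
Qed.

(** The multinomial theorem over the integers with denominators cleared, by induction on [r]:
    differentiating in a variable that occurs in [k] lowers both [r] and [k]. *)
Lemma mcoeff_sumX_exp n r (k : 'X_{1..n}) :
  ((\sum_(j < n) 'X_j : {mpoly int[n]}) ^+ r)@_k * (\prod_(j < n) (k j)`!)%:R =
  (r`!)%:R *+ (mdeg k == r).
Proof.
elim: r k => [|r IH] k.
  rewrite expr0 mcoeff1 mdeg_eq0; have [->|_] := eqVneq; last by rewrite mul0r.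
  by rewrite big1 ?mulr1// => j _; rewrite mnm0E.
have [->|k0] := eqVneq k 0%MM.
  rewrite mdeg0 mulr0n (rmorphXn (mcoeff 0%MM)) /= raddf_sum /= big1.
    by rewrite expr0n mul0r.
  by move=> j _; rewrite mcoeffX mnm1_eq0.
have [j kj] : exists j, k j != 0%N.
  apply/existsP; apply: contraNT k0 => /existsPn H.
  by apply/eqP/mnmP => j; rewrite mnm0E; apply/eqP; have := H j; rewrite negbK.
pose k' := (k - U_(j))%MM.
have kE : k = (k' + U_(j))%MM by rewrite submK// lep1mP.
have kE' i : k i = (k' i + (j == i))%N by rewrite kE mnmDE mnm1E.
have prodE : (\prod_(i < n) (k i)`! = (k' j).+1 * \prod_(i < n) (k' i)`!)%N.
  rewrite (bigD1 j)//= [in RHS](bigD1 j)//= kE' eqxx addn1 factS mulnA.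
  congr (_ * _)%N; apply: eq_bigr => i ij.
  by rewrite kE' eq_sym (negPf ij) addn0.
have degE : mdeg k = (mdeg k').+1 by rewrite kE mdegD mdeg1 addn1.
rewrite prodE natrM mulrA (mulr_natr _ (k' j).+1) degE eqSS factS.
rewrite [in LHS]kE -mcoeff_deriv.
by rewrite mderiv_sumX_exp mcoeffMn mulrnAl IH natrM mulr_natl mulrnAC.
Qed.

(** * The support of the powers of a polynomial *)

Section Support.
Variables (K : fieldType) (m n : nat) (a : 'I_n -> 'X_{1..m}).

Definition expo (k : 'I_n -> nat) : 'X_{1..m} := (\sum_(j < n) a j *+ k j)%MM.

Lemma expoE k i : expo k i = (\sum_(j < n) a j i * k j)%N.
Proof. by rewrite /expo mnm_sumE; apply: eq_bigr => j _; rewrite mulmnE. Qed.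

Lemma mpolyX_expo k : \prod_(j < n) 'X_[K, a j] ^+ k j = 'X_[expo k].
Proof. exact: mprodXnE. Qed.

(** The substitution of [c j *: 'X_[a j]] for ['X_j] carries the universal expansion over the
    integers to [K]. *)
Lemma exp_sum_mpolyX (c : 'I_n -> K) r :
  let P := (\sum_(j < n) 'X_j : {mpoly int[n]}) ^+ r in
  (\sum_(j < n) c j *: 'X_[a j]) ^+ r =
  \sum_(k <- msupp P) ((P@_k)%:~R * \prod_(j < n) c j ^+ k j) *: 'X_[expo k].
Proof.
move=> P.
pose phi : {rmorphism int -> {mpoly K[m]}} := intr.
transitivity (mmap phi (fun j => c j *: 'X_[a j]) P).
  rewrite /P rmorphXn raddf_sum /=; congr (_ ^+ _); apply: eq_bigr => j _.
  by rewrite mmapX mmap1U.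
apply: eq_bigr => k _; rewrite /phi /= /mmap1.
rewrite (eq_bigr _ (fun j _ => exprZn _ _ _)) scaler_prod mpolyX_expo.
by rewrite -[RHS]scalerA scaler_int mulrzl.
Qed.

Variable p : nat.
Hypothesis charK : p \in [pchar K].

Lemma intr_eq0_pchar (z : int) : (z%:~R == 0 :> K) = (p %| `|z|)%N.
Proof.
by case: z => M; rewrite ?NegzE ?mulrNz ?oppr_eq0 ?abszN -pmulrn (dvdn_pcharf charK).
Qed.

Lemma coef_sumX_exp_neq0 (k : 'X_{1..n}) :
  (((\sum_(j < n) 'X_j : {mpoly int[n]}) ^+ mdeg k)@_k)%:~R != 0 :> K <->
  no_carry p k.
Proof.
rewrite intr_eq0_pchar; apply: multinomial_ndvd; first exact: pcharf_prime charK.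
have /(congr1 absz) := mcoeff_sumX_exp (mdeg k) k.
by rewrite abszM eqxx mulr1n !natz !absz_nat mdegE.
Qed.

Variable f : {mpoly K[m]}.
Hypotheses (a_inj : injective a) (supp_f : msupp f =i codom a).

Lemma sum_support : f = \sum_(j < n) f@_(a j) *: 'X_[a j].
Proof.
rewrite {1}[f]mpolyE (perm_big (codom a)) /=; last first.
  by apply: uniq_perm supp_f; [exact: msupp_uniq|exact/injectiveP].
by rewrite big_map big_enum.
Qed.

Lemma coef_support_neq0 j : f@_(a j) != 0.
Proof. by rewrite -mcoeff_msupp supp_f codom_f. Qed.

(** A monomial of the power occurs in some term of the expansion whose multinomial coefficient is
    non-zero in [K]; by Kummer that term is free of carries. *)
Lemma msupp_exp r u : u \in msupp (f ^+ r) ->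
  exists k : 'X_{1..n}, [/\ mdeg k = r, u = expo k & no_carry p k].
Proof.
rewrite {1}sum_support exp_sum_mpolyX mcoeff_msupp raddf_sum /= => H.
set P := _ ^+ r in H.
have [k kP] : exists2 k, k \in msupp P &
    ((P@_k)%:~R * \prod_(j < n) f@_(a j) ^+ k j) * (expo k == u)%:R != 0.
  apply/hasP; apply: contraNT H => /hasPn H.
  rewrite big_seq big1// => k kP; rewrite mcoeffZ mcoeffX.
  by apply/eqP; have := H _ kP; rewrite negbK.
rewrite !mulf_eq0 !negb_or => /andP[/andP[c0 _] e].
(* Coefficients of [P] in degrees other than [r] vanish. *)
exists k; have dk : mdeg k = r.
  apply/eqP; move: c0; apply: contraNT => dk.
  have := mcoeff_sumX_exp r k; rewrite (negPf dk) mulr0n => /eqP.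
  rewrite mulf_eq0 pnatr_eq0 -[(_ == 0)%N]negbK -lt0n prodn_gt0 ?orbF; last first.
    by move=> j; exact: fact_gt0.
  by move/eqP => ->.
split=> //; first by apply/esym/eqP; move: e; case: (expo k == u) => //=; rewrite eqxx.
by apply/coef_sumX_exp_neq0; rewrite dk.
Qed.

(** Uniqueness of [k] excludes cancellation: the coefficient is a single multinomial coefficient,
    prime to p, times a product of non-zero coefficients of [f]. *)
Lemma expo_in_msupp_exp (k : 'X_{1..n}) : no_carry p k ->
  (forall k' : 'X_{1..n}, mdeg k' = mdeg k -> expo k' = expo k -> k' = k) ->
  expo k \in msupp (f ^+ mdeg k).
Proof.
move=> nc uniq_k; rewrite [in f ^+ _]sum_support exp_sum_mpolyX mcoeff_msupp raddf_sum /=.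
set P := _ ^+ mdeg k; have Pk : (P@_k)%:~R != 0 :> K by exact/coef_sumX_exp_neq0.
have kP : k \in msupp P.
  by rewrite mcoeff_msupp; apply: contraNN Pk => /eqP ->.
rewrite (bigD1_seq k) ?msupp_uniq//= mcoeffZ mcoeffX eqxx mulr1.
rewrite [X in _ + X]big_seq_cond [X in _ + X]big1 ?addr0; last first.
  move=> k' /andP[k'P k'k]; rewrite mcoeffZ mcoeffX.
    case: eqP => e; last by rewrite mulr0.
  have dk' : mdeg k' = mdeg k.
    apply/eqP; move: k'P; rewrite mcoeff_msupp; apply: contraNT => dk'.
    have := mcoeff_sumX_exp (mdeg k) k'; rewrite (negPf dk') mulr0n => /eqP.
    rewrite mulf_eq0 pnatr_eq0 -[(_ == 0)%N]negbK -lt0n prodn_gt0 ?orbF//.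
    by move=> j; exact: fact_gt0.
  by rewrite (uniq_k _ dk' e) eqxx in k'k.
by rewrite mulf_neq0//; apply/prodf_neq0 => j _; rewrite expf_neq0// coef_support_neq0.
Qed.

End Support.

(** * Membership in the Frobenius powers of the maximal ideal *)

Section FrobeniusPower.
Variables (K : fieldType) (m : nat).
Implicit Types (g h : {mpoly K[m]}).

Lemma frobenius_max_idealP q g :
  frobenius_max_ideal K m q g <-> forall u, u \in msupp g -> exists i, (q <= u i)%N.
Proof.
split=> [[k [c [x [Sx ->]]]] u|H].
  move/msupp_sum_le => /flatten_mapP[i _].
  have [l _ <-] := Sx i; rewrite mpolyXn => /msuppM_le /allpairsP[[u1 u2] /= [_ + ->]].
  rewrite msuppX inE => /eqP ->; exists l.
  by rewrite mnmDE mulmnE mnm1E eqxx mul1n leq_addl.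
have [i0 _|noi] := pickP (xpredT : pred 'I_m); last first.
  exists 0%N, (fun=> 0), (fun=> 0); split=> [[]//|]; rewrite big_ord0.
  apply/msuppnil0; case: (msupp g) H => // u s /(_ u (mem_head _ _)) [i].
  by have := noi i.
(* [w u] is a variable whose q-th power divides the monomial; dividing each term of [g] by that
   power yields the cofactors. *)
pose w (u : 'X_{1..m}) := odflt i0 [pick i | (q <= u i)%N].
have wP u : u \in msupp g -> (q <= u (w u))%N.
  by move=> /H[i qi]; rewrite /w; case: pickP => //= /(_ i); rewrite qi.
exists (size (msupp g)), (fun i => g@_(nth 0%MM (msupp g) i) *:
    'X_[nth 0%MM (msupp g) i - U_(w (nth 0%MM (msupp g) i)) *+ q]),
  (fun i => 'X_(w (nth 0%MM (msupp g) i)) ^+ q).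
split=> [i|]; first by exists (w (nth 0%MM (msupp g) i)).
rewrite {1}[g]mpolyE (big_nth 0%MM) big_mkord; apply: eq_bigr => i _.
rewrite -scalerAl mpolyXn -mpolyXD submK//.
apply/mnm_lepP => l; rewrite mulmnE mnm1E; case: eqP => [<-|_]; last by rewrite mul0n.
by rewrite mul1n wP// mem_nth.
Qed.

Lemma mpoly_exp_pchar p g : p \in [pchar K] ->
  g ^+ p = \sum_(u <- msupp g) (g@_u ^+ p) *: 'X_[u *+ p].
Proof.
move=> charK; have charM : p \in [pchar {mpoly K[m]}].
  by rewrite !inE (pcharf_prime charK) -mpolyC_nat (pcharf0 charK) mpolyC0 eqxx.
rewrite -(pFrobenius_autE charM) {1}[g]mpolyE raddf_sum; apply: eq_bigr => u _.
by rewrite /= pFrobenius_autE exprZn mpolyXn.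
Qed.

(** In characteristic p, the monomials of [g ^+ p] are those of [g] with exponents multiplied by p:
    distinct ones stay distinct and no coefficient vanishes. *)
Lemma frobenius_max_ideal_exp p q g : p \in [pchar K] ->
  frobenius_max_ideal K m (q * p) (g ^+ p) <-> frobenius_max_ideal K m q g.
Proof.
move=> charK; have p0 : (0 < p)%N by exact: prime_gt0 (pcharf_prime charK).
rewrite !frobenius_max_idealP mpoly_exp_pchar//.
have mulp_inj : injective (fun u : 'X_{1..m} => (u *+ p)%MM).
  move=> u v /mnmP e; apply/mnmP => i; have := e i; rewrite !mulmnE => /eqP.
  by rewrite eqn_pmul2r// => /eqP.
split=> H u.
  move=> ug; have [|i] := H (u *+ p)%MM.
    rewrite mcoeff_msupp raddf_sum /= (bigD1_seq u) ?msupp_uniq//= big1.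
      by rewrite addr0 mcoeffZ mcoeffX eqxx mulr1 expf_neq0// -mcoeff_msupp.
    move=> v vu; rewrite mcoeffZ mcoeffX.
    case: eqP => [/mulp_inj e|_]; last by rewrite mulr0.
    by rewrite e eqxx in vu.
  by rewrite mulmnE leq_pmul2r//; exists i.
rewrite mcoeff_msupp raddf_sum /= => u0.
have [v vg] : exists2 v, v \in msupp g & (v *+ p)%MM == u.
  apply/hasP; apply: contraNT u0 => /hasPn vu.
  rewrite big_seq big1// => v /vu; rewrite mcoeffZ mcoeffX => /negPf ->; exact: mulr0.
move=> /eqP <-; have [i qi] := H _ vg; exists i.
by rewrite mulmnE leq_pmul2r.
Qed.

End FrobeniusPower.

(** * Powers of principal and of monomial ideals *)

Section Ideals.
Variables (K : fieldType) (m : nat).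
Implicit Types (g h x : {mpoly K[m]}) (I : {mpoly K[m]} -> Prop).

(** The polynomials with all exponents in an upward closed set [U] form an ideal. *)
Lemma ideal_gen_msupp (U : 'X_{1..m} -> Prop) (S : {mpoly K[m]} -> Prop) :
  (forall u v, U u -> U (v + u)%MM) ->
  (forall g, S g -> forall u, u \in msupp g -> U u) ->
  forall x, ideal_gen S x -> forall u, u \in msupp x -> U u.
Proof.
move=> Uup SU x [k [c [g [Sg ->]]]] u /msupp_sum_le/flatten_mapP[i _].
by move=> /msuppM_le/allpairsP[[u1 u2] /= [_ u2g ->]]; apply/Uup/(SU (g i)).
Qed.

Lemma mem_ideal_gen (S : {mpoly K[m]} -> Prop) x : S x -> ideal_gen S x.
Proof.
by move=> Sx; exists 1%N, (fun=> 1), (fun=> x); rewrite big_ord1 mul1r.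
Qed.

Lemma ideal_pow_prod I r (g : 'I_r -> {mpoly K[m]}) :
  (forall i, I (g i)) -> ideal_pow I r (\prod_(i < r) g i).
Proof. by move=> Ig; apply: mem_ideal_gen; exists g. Qed.

Lemma ideal_pow_exp I r x : I x -> ideal_pow I r (x ^+ r).
Proof.
move=> Ix; rewrite -[r in x ^+ r]card_ord -prodr_const.
exact: (@ideal_pow_prod _ _ (fun=> x)).
Qed.

Lemma principal_ideal_pow_sub f r q :
  (forall x, ideal_pow (ideal_gen (eq^~ f)) r x -> frobenius_max_ideal K m q x) <->
  frobenius_max_ideal K m q (f ^+ r).
Proof.
split=> [H|/frobenius_max_idealP fr x].
  by apply: H; apply: ideal_pow_exp; exact: mem_ideal_gen.
move=> H; apply/frobenius_max_idealP; move: x H; apply: ideal_gen_msupp.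
  by move=> u v [i qi]; exists i; rewrite mnmDE (leq_trans qi) ?leq_addl.
move=> _ [g [gI ->]].
have [h gE] : exists h : 'I_r -> {mpoly K[m]}, forall i, g i = h i * f.
  apply: (fin_all_exists (P := fun i hi => g i = hi * f)) => i.
  have [k [c [x [xf ->]]]] := gI i; exists (\sum_(j < k) c j).
  by rewrite mulr_suml; apply: eq_bigr => j _; rewrite xf.
move=> u; rewrite (eq_bigr _ (fun i _ => gE i)) big_split /= prodr_const card_ord.
move=> /msuppM_le/allpairsP[[u1 u2] /= [_ /fr[i qi] ->]]; exists i.
by rewrite mnmDE (leq_trans qi) ?leq_addl.
Qed.

Variables (n : nat) (a : 'I_n -> 'X_{1..m}).

(** The generators are written so as to be convertible with the image set in [fpt_monomials]. *)
Definition monomial_ideal : {mpoly K[m]} -> Prop :=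
  ideal_gen (fun x => exists2 j, True & 'X_[K, a j] = x).

Lemma mem_monomial_ideal f : msupp f =i codom a -> injective a -> monomial_ideal f.
Proof.
move=> sf a_inj; exists n, (fun j => (f@_(a j))%:MP), (fun j => 'X_[a j]); split.
  by move=> j; exists j.
by rewrite {1}(sum_support a_inj sf); apply: eq_bigr => j _; rewrite mul_mpolyC.
Qed.

(** Stated for every [I] inside the monomial ideal, so as to serve for the ideal of [f] as well. By
    induction on [r]: each new factor contributes a generator [a j], which increments [k] at j. *)
Lemma msupp_monomial_ideal_pow I r x : (forall y, I y -> monomial_ideal y) ->
  ideal_pow I r x -> forall u, u \in msupp x ->
  exists k : 'X_{1..n}, mdeg k = r /\ (expo a k <= u)%MM.
Proof.
move=> IM; pose U r u := exists k : 'X_{1..n}, mdeg k = r /\ (expo a k <= u)%MM.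
have Uup s u v : U s u -> U s (v + u)%MM.
  by move=> [k [dk ku]]; exists k; split=> //; exact: lepm_trans ku (lem_addl _ _).
apply: (@ideal_gen_msupp (U r)); first exact: Uup.
move=> _ [g [Ig ->]]; elim: r g Ig => [|r IH] g Ig u.
  rewrite big_ord0 msupp1 inE => /eqP ->; exists 0%MM; rewrite mdeg0; split=> //.
  by apply/mnm_lepP => i; rewrite expoE big1// => j _; rewrite mnm0E muln0.
rewrite big_ord_recl => /msuppM_le/allpairsP[[u1 u2] /= [u1g u2g ->]].
have [k [dk ku]] := IH _ (fun i => Ig (lift ord0 i)) _ u2g.
have [j ju] : exists j, (a j <= u1)%MM.
  move: u1g.
  apply: (@ideal_gen_msupp (fun u => exists j, (a j <= u)%MM) _ _ _ _ (IM _ (Ig _))).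
    by move=> v w [j jv]; exists j; exact: lepm_trans jv (lem_addl _ _).
  by move=> _ [j _ <-] v; rewrite msuppX inE => /eqP ->; exists j; exact: lepm_refl.
exists (k + U_(j))%MM; rewrite mdegD mdeg1 addn1 dk; split=> //.
apply/mnm_lepP => i; rewrite mnmDE expoE.
rewrite (eq_bigr (fun l => a l i * k l + a l i * (j == l))%N).
  rewrite big_split /= -expoE [X in (_ + X)%N](bigD1 j)//= eqxx muln1 big1.
    by rewrite addn0 addnC; apply: leq_add; [move/mnm_lepP: ju|move/mnm_lepP: ku].
  by move=> l lj; rewrite eq_sym (negPf lj) muln0.
by move=> l _; rewrite mnmDE mnm1E mulnDr.
Qed.

Lemma ideal_pow_nsub_expo I r q : (forall y, I y -> monomial_ideal y) ->
  ~ (forall x, ideal_pow I r x -> frobenius_max_ideal K m q x) ->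
  exists k : 'X_{1..n}, mdeg k = r /\ forall i, (expo a k i < q)%N.
Proof.
move=> IM H; apply: contrapT => nok; apply: H => x xI.
apply/frobenius_max_idealP => u ux; apply: contrapT => noi; apply: nok.
have [k [dk /mnm_lepP ku]] := msupp_monomial_ideal_pow IM xI ux.
exists k; split=> // i; apply: leq_ltn_trans (ku i) _.
by rewrite ltnNge; apply/negP => qi; apply: noi; exists i.
Qed.

Lemma expo_ideal_pow_nsub (k : 'X_{1..n}) q : (forall i, (expo a k i < q)%N) ->
  ~ (forall x, ideal_pow monomial_ideal (mdeg k) x -> frobenius_max_ideal K m q x).
Proof.
move=> kq H.
have /H/frobenius_max_idealP/(_ (expo a k)) :
    ideal_pow monomial_ideal (mdeg k) 'X_[expo a k].
  (* [s] lists every index j with multiplicity [k j], which displays the monomial as a product of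
     [mdeg k] generators. *)
  pose s := flatten [seq nseq (k j) j | j <- enum 'I_n].
  have sk : mdeg k = size s.
    rewrite /s size_flatten /shape -map_comp sumnE big_map big_enum mdegE /=.
    by apply: eq_bigr => j _; rewrite size_nseq.
  have -> : 'X_[K, expo a k] = \prod_(i < size s) 'X_[a (tnth (in_tuple s) i)].
    rewrite -(big_tnth _ _ s xpredT (fun j => 'X_[a j])) big_flatten big_map big_enum /=.
    rewrite -mpolyX_expo; apply: eq_bigr => j _.
    by rewrite big_nseq -Monoid.iteropE.
  rewrite sk; apply: ideal_pow_prod => i; apply: mem_ideal_gen.
  by exists (tnth (in_tuple s) i).
by rewrite msuppX mem_head => /(_ isT)[i]; rewrite leqNgt kq.
Qed.

(** The maximum exists, so that [xget] returns it: the zeroth power contains 1, and the admissible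
    exponents are at most [m * q] since each [a j] has a positive entry. *)
Lemma fpt_nuP I q : (forall y, I y -> monomial_ideal y) -> (forall j, a j <> 0%MM) ->
  (0 < q)%N ->
  ~ (forall x, ideal_pow I (fpt_nu I q) x -> frobenius_max_ideal K m q x) /\
  forall s, ~ (forall x, ideal_pow I s x -> frobenius_max_ideal K m q x) ->
    (s <= fpt_nu I q)%N.
Proof.
move=> IM a0 q0.
pose P s := `[< ~ (forall x, ideal_pow I s x -> frobenius_max_ideal K m q x) >].
have P0 : P 0%N.
  apply/asboolP => H; have /H/frobenius_max_idealP/(_ 0%MM) : ideal_pow I 0 1.
    have := @ideal_pow_prod I 0 (fun=> 1); rewrite big_ord0; by apply=> -[].
  by rewrite msupp1 mem_head => /(_ isT)[i]; rewrite mnm0E leqNgt q0.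
have Pb s : P s -> (s <= m * q)%N.
  move/asboolP => /(ideal_pow_nsub_expo IM)[k [<- kq]].
  apply: (@leq_trans (\sum_(i < m) expo a k i)).
    rewrite (eq_bigr _ (fun i _ => expoE a k i)) exchange_big mdegE /=.
    apply: leq_sum => j _; rewrite -big_distrl /= leq_pmull// lt0n -mdegE.
    by rewrite mdeg_eq0; apply/eqP.
  rewrite -[m in (m * q)%N]card_ord -sum_nat_const; apply: leq_sum => i _.
  exact: ltnW.
have [M /asboolP PM Mmax] := ex_maxnP (ex_intro P 0%N P0) Pb.
rewrite /fpt_nu; case: classical_sets.xgetP => [r _ rP|/(_ M)].
  by [].
by case; split=> // s /asboolP; exact: Mmax.
Qed.

End Ideals.
Arguments monomial_ideal K {m n} a _.

(** * The function nu of a polynomial and of its monomials *)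

Section FrobeniusThreshold.
Variables (K : fieldType) (m n p : nat) (a : 'I_n -> 'X_{1..m}) (f : {mpoly K[m]}).
Hypotheses (charK : p \in [pchar K]) (a_inj : injective a).
Hypotheses (a_neq0 : forall j, a j <> 0%MM) (supp_f : msupp f =i codom a).

Local Notation nu q := (fpt_nu (ideal_gen (eq^~ f)) q).
Local Notation nuM q := (fpt_nu (monomial_ideal K a) q).

Let p_gt0 : (0 < p)%N.
Proof. exact: prime_gt0 (pcharf_prime charK). Qed.

Lemma principal_sub_monomial_ideal y : ideal_gen (eq^~ f) y -> monomial_ideal K a y.
Proof.
move=> [k [c [g [gf ->]]]].
have [l [d [h [hM fE]]]] := mem_monomial_ideal supp_f a_inj.
exists l, (fun j => (\sum_(i < k) c i) * d j), h; split=> //.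
rewrite -(eq_bigr _ (fun j _ => mulrA _ _ _)) -mulr_sumr -fE mulr_suml.
by apply: eq_bigr => i _; rewrite gf.
Qed.

Lemma fpt_nu_expo I q : (forall y, I y -> monomial_ideal K a y) -> (0 < q)%N ->
  exists k : 'I_n -> nat, (\sum_(j < n) k j = fpt_nu I q)%N /\
    forall i, (\sum_(j < n) a j i * k j < q)%N.
Proof.
move=> IM q0; have [nuI _] := fpt_nuP IM a_neq0 q0.
have [k [dk kq]] := ideal_pow_nsub_expo IM nuI.
by exists k; split=> [|i]; [rewrite -mdegE|rewrite -expoE].
Qed.

Lemma le_fpt_nu_monomials (k : 'I_n -> nat) q : (0 < q)%N ->
  (forall i, \sum_(j < n) a j i * k j < q)%N -> (\sum_(j < n) k j <= nuM q)%N.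
Proof.
move=> q0 kq; pose k' := [multinom k j | j < n].
have k'E j : k' j = k j by rewrite mnmE.
rewrite -(eq_bigr _ (fun j _ => k'E j)) -mdegE.
apply: (proj2 (fpt_nuP _ a_neq0 q0)) => //; apply: expo_ideal_pow_nsub => i.
by rewrite expoE (eq_bigr _ (fun j _ => congr1 (muln _) (k'E j))).
Qed.

(** Once a power of [f] lies in the Frobenius power, so do all higher ones; hence a single power
    decides. *)
Lemma fpt_nu_principalP q r : (0 < q)%N ->
  (r <= nu q)%N <-> ~ frobenius_max_ideal K m q (f ^+ r).
Proof.
move=> q0; have [nuf nu_max] := fpt_nuP principal_sub_monomial_ideal a_neq0 q0.
split=> [r_nu|]; last by move=> H; apply: nu_max => /principal_ideal_pow_sub.
rewrite principal_ideal_pow_sub in nuf; apply: contra_not nuf.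
move=> /frobenius_max_idealP fr; apply/frobenius_max_idealP => u.
rewrite -(subnK r_nu) exprD => /msuppM_le/allpairsP[[u1 u2] /= [_ /fr[i qi] ->]].
by exists i; rewrite mnmDE (leq_trans qi) ?leq_addl.
Qed.

Lemma le_fpt_nu_principal (k : 'I_n -> nat) q : (0 < q)%N -> no_carry p k ->
  (forall i, \sum_(j < n) a j i * k j < q)%N ->
  (forall k' : 'I_n -> nat, (\sum_(j < n) k' j = \sum_(j < n) k j)%N ->
     (forall i, \sum_(j < n) a j i * k' j = \sum_(j < n) a j i * k j)%N -> k' =1 k) ->
  (\sum_(j < n) k j <= nu q)%N.
Proof.
move=> q0 nck kq k_uniq; pose k' := [multinom k j | j < n].
have k'E j : k' j = k j by rewrite mnmE.
have expoE' i : expo a k' i = (\sum_(j < n) a j i * k j)%N.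
  by rewrite expoE; apply: eq_bigr => j _; rewrite k'E.
have mdegE' : mdeg k' = (\sum_(j < n) k j)%N by rewrite mdegE; apply: eq_bigr.
rewrite -mdegE'; apply/fpt_nu_principalP => // /frobenius_max_idealP.
move=> /(_ (expo a k')) []; last by move=> i; rewrite expoE' leqNgt kq.
apply: (expo_in_msupp_exp charK) => //.
  by apply: (eq_no_carry (fun j => esym (k'E j))).
move=> l dl el; apply/mnmP => j; rewrite k'E; apply: k_uniq => [|i].
  by rewrite -mdegE dl.
by rewrite -expoE el.
Qed.

Lemma no_carry_of_le_fpt_nu r q : (0 < q)%N -> (r <= nu q)%N ->
  exists k : 'I_n -> nat, [/\ (\sum_(j < n) k j = r)%N,
    (forall i, \sum_(j < n) a j i * k j < q)%N & no_carry p k].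
Proof.
move=> q0 /fpt_nu_principalP -/(_ q0) fr.
have [u [ur uq]] : exists u, u \in msupp (f ^+ r) /\ forall i, (u i < q)%N.
  apply: contrapT => nou; apply: fr; apply/frobenius_max_idealP => u ur.
  apply: contrapT => noi; apply: nou; exists u; split=> // i.
  by rewrite ltnNge; apply/negP => qi; apply: noi; exists i.
have [k [dk uk nck]] := msupp_exp charK a_inj supp_f ur.
by exists k; split=> // [|i]; rewrite -?mdegE -?expoE -?uk.
Qed.

(** The condition under which [base_approx_cvg] applies: the values of nu at powers of p behave like
    the numerators of the base p truncations of a number. *)
Lemma fpt_nu_principal_mulp q : (0 < q)%N ->
  (p * nu q <= nu (q * p) < p * (nu q).+1)%N.
Proof.
move=> q0; have qp0 : (0 < q * p)%N by rewrite muln_gt0 q0.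
apply/andP; split.
  apply/fpt_nu_principalP => //; rewrite [(p * _)%N]mulnC exprM frobenius_max_ideal_exp//.
  by apply/fpt_nu_principalP.
rewrite ltnNge; apply/negP => /fpt_nu_principalP -/(_ qp0).
rewrite [(p * _)%N]mulnC exprM frobenius_max_ideal_exp// => /fpt_nu_principalP -/(_ q0).
by rewrite ltnn.
Qed.

End FrobeniusThreshold.
End Polynomials.

From mathcomp Require Import all_classical all_reals all_analysis.
Import numFieldNormedType.Exports.
Local Open Scope classical_set_scope.
Local Open Scope ring_scope.

(** * Expansions in base p *)

Section BaseExpansions.
Variables (R : realType) (p : nat).
Hypothesis p_gt1 : (1 < p)%N.

Let pX_gt0 N : 0 < p%:R ^+ N :> R.
Proof. by rewrite exprn_gt0// ltr0n ltnW. Qed.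

Lemma cvg_invX_base : (fun N => (p%:R ^+ N)^-1 : R) @ \oo --> (0 : R).
Proof.
under eq_fun do rewrite -exprVn.
apply: cvg_expr; rewrite ger0_norm ?invr_ge0// invf_lt1 ?ltr1n//.
by rewrite ltr0n ltnW.
Qed.

(** Nested intervals: by hypothesis each interval is one of the p equal pieces of the preceding
    one. *)
Lemma base_approx_mono (T : nat -> nat) :
  (forall N, (p * T N <= T N.+1 < p * (T N).+1)%N) ->
  forall N M, (N <= M)%N ->
  (T N)%:R / p%:R ^+ N <= (T M)%:R / p%:R ^+ M :> R /\
  (T M).+1%:R / p%:R ^+ M <= (T N).+1%:R / p%:R ^+ N :> R.
Proof.
move=> HT N; elim=> [|M IH].
  by rewrite leqn0 => /eqP ->.
rewrite leq_eqVlt => /orP[/eqP <-//|/IH[l u]].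
have /andP[T1 T2] := HT M.
split; [apply: le_trans l _|apply: le_trans u].
- rewrite ler_pdivrMr// mulrAC ler_pdivlMr// exprS mulrA ler_pM2r//.
  by rewrite -natrM mulnC ler_nat.
- rewrite ler_pdivrMr// mulrAC ler_pdivlMr// exprS mulrA ler_pM2r//.
  by rewrite -natrM mulnC ler_nat.
Qed.

(** Serves both for truncated expansions and for nu at powers of p. *)
Lemma base_approx_cvg (T : nat -> nat) :
  (forall N, (p * T N <= T N.+1 < p * (T N).+1)%N) ->
  exists l : R, (fun N => (T N)%:R / p%:R ^+ N) @ \oo --> l /\
    forall N, (T N)%:R / p%:R ^+ N <= l <= (T N).+1%:R / p%:R ^+ N.
Proof.
move=> HT; pose u N : R := (T N)%:R / p%:R ^+ N.
have ub N M : u N <= (T M).+1%:R / p%:R ^+ M.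
  have [NM|/ltnW MN] := leqP N M.
    apply: (le_trans (proj1 (base_approx_mono HT NM))).
    by rewrite ler_pM2r ?invr_gt0// ler_nat.
  apply: (le_trans _ (proj2 (base_approx_mono HT MN))).
  by rewrite ler_pM2r ?invr_gt0// ler_nat.
have und : nondecreasing_seq u.
  by move=> N M NM; exact: (proj1 (base_approx_mono HT NM)).
have ucvg : cvgn u.
  apply: nondecreasing_is_cvgn => //; exists ((T 0%N).+1%:R / p%:R ^+ 0).
  by move=> _ [N _ <-]; exact: ub.
exists (limn u); split=> // N; apply/andP; split.
  exact: nondecreasing_cvgn_le.
by apply: limr_le => //; near=> M; exact: ub.
Unshelve. all: by end_near. Qed.

(** Strictness on the left is the rounding of non-terminating expansions, so [T] is the ceiling of
    [y] minus 1. *)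
Lemma ex_nat_floor (y : R) : 0 < y -> exists T : nat, T%:R < y <= T.+1%:R.
Proof.
move=> y0; have := ceil_itv y; have := ceil_gt0 y; rewrite y0.
case: (Num.ceil y) => [[|T]|//] // _.
rewrite [Posz T.+1]intS addrC addKr.
by move=> /andP[T1 T2]; exists T; rewrite T1.
Qed.

(** The numerator of the N-th truncation over [p ^ N], by Horner's rule. *)
Fixpoint digit_num (d : nat -> nat) (N : nat) : nat :=
  if N is N'.+1 then (p * digit_num d N' + d N)%N else 0%N.

Lemma digit_sum_num d N : digit_sum R p d N = (digit_num d N)%:R / p%:R ^+ N.
Proof.
elim: N => [|N IH]; first by rewrite /digit_sum big_geq// mul0r.
rewrite /digit_sum big_nat_recr//= -/(digit_sum R p d N) IH natrD natrM exprS.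
by field; rewrite expf_neq0 pnatr_eq0 -lt0n ltnW.
Qed.

Lemma digit_num_step d : (forall e, (d e <= p.-1)%N) ->
  forall N, (p * digit_num d N <= digit_num d N.+1 < p * (digit_num d N).+1)%N.
Proof. by move=> dp N /=; have := dp N.+1; move: p_gt1; nia. Qed.

Lemma nonterminating_expansion_bounds (x : R) d : nonterminating_expansion p x d ->
  forall N, (digit_num d N)%:R / p%:R ^+ N < x <= (digit_num d N).+1%:R / p%:R ^+ N.
Proof.
move=> [d0 dp dnt dx] N.
have [l [lc lb]] := base_approx_cvg (digit_num_step dp).
have <- : l = x.
  apply: (cvg_unique (@Rhausdorff R) lc).
  rewrite /= (_ : (fun N => (digit_num d N)%:R / p%:R ^+ N) = digit_sum R p d)//.
  by apply/funext => M; rewrite digit_sum_num.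
have /andP[_ ->] := lb N; rewrite andbT.
(* A non-zero digit beyond [N] makes the lower bound strict. *)
have [e Ne de] : exists2 e, (N < e)%N & (0 < d e)%N.
  apply: contrapT => noe; apply: dnt; exists N.+1 => e Ne.
  by apply/eqP; rewrite -leqn0 leqNgt; apply/negP => de; apply: noe; exists e.
case: e => [|e] in Ne de *; [by []|rewrite ltnS in Ne].
apply: le_lt_trans (proj1 (base_approx_mono (digit_num_step dp) Ne)) _.
have /andP[+ _] := lb e.+1; apply: lt_le_trans.
rewrite ltr_pdivrMr// mulrAC ltr_pdivlMr// exprS mulrA ltr_pM2r//.
by rewrite -natrM mulnC ltr_nat /= -[X in (X < _)%N]addn0 ltn_add2l.
Qed.

Lemma nonterminating_expansion_ex (x : R) : 0 < x <= 1 ->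
  exists d, nonterminating_expansion p x d.
Proof.
move=> /andP[x0 x1].
have /choice[T HT] N : exists T : nat, T%:R < p%:R ^+ N * x <= T.+1%:R.
  by apply: ex_nat_floor; rewrite mulr_gt0.
have step N : (p * T N <= T N.+1 < p * (T N).+1)%N.
  have /andP[a b] := HT N; have /andP[a' b'] := HT N.+1.
  move: a' b'; rewrite exprS -mulrA => a' b'.
  have p0 : 0 < p%:R :> R by rewrite ltr0n ltnW.
  rewrite -(ltr_nat R) -ltnS -(ltr_nat R) !natrM.
  rewrite (lt_le_trans _ b') ?ltr_pM2l//=.
  by rewrite (lt_le_trans a')// ler_pM2l.
have T0 : T 0%N = 0%N.
  have /andP[a _] := HT 0%N; move: a; rewrite expr0 mul1r => a.
  by have := lt_le_trans a x1; rewrite ltrn1; case: (T 0%N).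
pose d N := if N is N'.+1 then (T N'.+1 - p * T N')%N else 0%N.
have dT N : digit_num d N = T N.
  elim: N => [//|N IH] /=; rewrite IH subnKC//; by have /andP[] := step N.
have bnd N : (T N)%:R / p%:R ^+ N < x <= (T N).+1%:R / p%:R ^+ N.
  by rewrite ltr_pdivrMr// ler_pdivlMr// mulrC HT.
have [l [lc lb]] := base_approx_cvg step.
have lx : l = x.
  apply/eqP; rewrite -subr_eq0 -normr_le0; apply/ler_addgt0Pr => e e0.
  rewrite add0r.
  have := cvg_invX_base => /cvgrPdist_lt/(_ _ e0)[N _ /(_ N)/= /(_ (leqnn _))].
  rewrite sub0r normrN gtr0_norm ?invr_gt0// => /ltW; apply: le_trans.
  have := lb N; have /andP[a b] := bnd N.
  move: b; rewrite -addn1 natrD mulrDl mul1r => b /andP[a' b'].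
  by rewrite ler_norml; apply/andP; split; lra.
exists d; split=> //.
- case=> [//|e] /=; have := step e; move: p_gt1; nia.
- move=> [N dN].
  (* If all digits from [N] on vanished, the truncations would be constant from there and equal to
     x, against the strict bound. *)
  have TN M : (T (N + M)%N)%:R / p%:R ^+ (N + M) = (T N)%:R / p%:R ^+ N :> R.
    elim: M => [|M IH]; first by rewrite addn0.
    rewrite -IH addnS; have -> : T (N + M)%N.+1 = (p * T (N + M))%N.
      have := dN (N + M)%N.+1; rewrite -addnS leq_addr => /(_ isT).
      by rewrite addnS /=; have := step (N + M)%N; lia.
    by rewrite natrM exprS invfM mulrACA divff ?mul1r// pnatr_eq0 -lt0n ltnW.
  have : l = (T N)%:R / p%:R ^+ N.
    apply: (cvg_unique (@Rhausdorff R) lc); rewrite /= -(cvg_shiftn N).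
    under eq_fun do rewrite addnC TN.
    exact: cvg_cst.
  by have /andP[+ _] := bnd N; rewrite lx => /[swap] ->; rewrite ltxx.
- rewrite -lx (_ : digit_sum R p d = fun N => (T N)%:R / p%:R ^+ N)//.
  by apply/funext => M; rewrite digit_sum_num dT.
Qed.

End BaseExpansions.

(** * Digits, truncations and the carry-free length *)

Section Digits.
Variables (R : realType) (p : nat).
Hypothesis p_gt1 : (1 < p)%N.

Local Notation trunc_num x N := (digit_num p (digit p (x : R)) N).

Let pX_gt0 N : 0 < p%:R ^+ N :> R.
Proof. by rewrite exprn_gt0// ltr0n ltnW. Qed.

Lemma digit_le (x : R) e : (digit p x e <= p.-1)%N.
Proof. by rewrite /digit; case: xgetP => [d _ [_]|]. Qed.

Lemma digit_at0 (x : R) : digit p x 0 = 0%N.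
Proof. by rewrite /digit; case: xgetP => [d _ []|]. Qed.

(** A non-terminating expansion has a positive value, so that [xget] returns its default. *)
Lemma digit0 : digit p (0 : R) = fun=> 0%N.
Proof.
rewrite /digit; case: xgetP => [d _ dP|//].
have /andP[+ _] := nonterminating_expansion_bounds p_gt1 dP 0.
by rewrite mul0r ltxx.
Qed.

Lemma digit_num0 N : trunc_num 0 N = 0%N.
Proof. by rewrite digit0; elim: N => //= N ->; rewrite muln0. Qed.

Lemma digit_num_bounds (x : R) N : 0 < x <= 1 ->
  (trunc_num x N)%:R < p%:R ^+ N * x <= (trunc_num x N).+1%:R.
Proof.
move=> x01; rewrite mulrC -ltr_pdivrMr// -ler_pdivlMr//.
apply: nonterminating_expansion_bounds => //.
exact: xgetPex (nonterminating_expansion_ex p_gt1 x01).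
Qed.

(** The first alternative covers x = 0, where the truncation is not strictly smaller. *)
Lemma digit_num_lt (x : R) N : 0 <= x <= 1 ->
  trunc_num x N = 0%N \/ (trunc_num x N)%:R < p%:R ^+ N * x.
Proof.
move=> /andP[]; rewrite le_eqVlt => /orP[/eqP <- _|x0 x1].
  by left; rewrite digit_num0.
by right; have /(digit_num_bounds N)/andP[] : 0 < x <= 1 by rewrite x0.
Qed.

Lemma digit_num_ge (x : R) N : 0 <= x <= 1 ->
  p%:R ^+ N * x <= (trunc_num x N).+1%:R.
Proof.
move=> /andP[]; rewrite le_eqVlt => /orP[/eqP <- _|x0 x1]; first by rewrite mulr0.
by have /(digit_num_bounds N)/andP[] : 0 < x <= 1 by rewrite x0.
Qed.

(** Truncating one place further appends lowest digits, for which [no_carry_digit] asks exactly the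
    condition at that place. *)
Lemma carry_free_uptoE n (s : 'cV[R]_n) e :
  carry_free_upto p s e <-> no_carry p (fun j => trunc_num (s j 0) e).
Proof.
have p0 : (0 < p)%N by exact: ltnW.
have lep k : (k <= p.-1)%N = (k < p)%N by rewrite -ltnS prednK.
elim: e => [|e IH].
  split=> [_|_ d]; first exact: no_carry0.
  by rewrite leqn0 => /eqP ->; rewrite big1// => j _; exact: digit_at0.
rewrite /= no_carry_digit//; last by move=> j; rewrite -lep digit_le.
rewrite -IH; split=> [H|[H1 H2] d].
  by split; [move=> d /leqW/H|rewrite -lep H].
by rewrite leq_eqVlt => /orP[/eqP ->|/H1//]; rewrite lep.
Qed.

Lemma carry_free_length_pinfty n (s : 'cV[R]_n) :
  carry_free_length p s = +oo%E <-> forall e, carry_free_upto p s e.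
Proof.
split=> [H e|H].
  apply: contrapT => ne.
  have : (carry_free_length p s <= e%:R%:E)%E.
    apply: ge_ereal_sup => _ [d /= sd <-]; rewrite lee_fin ler_nat.
    rewrite leqNgt; apply/negP => ed; apply: ne => c ce; apply: sd.
    exact: leq_trans ce (ltnW ed).
  by rewrite H.
apply/eqyP => r r0.
apply: (@le_trans _ _ ((Num.bound r)%:R%:E)).
  by rewrite lee_fin ltW// archi_boundP// ltW.
by apply: ereal_sup_ubound; exists (Num.bound r) => //; exact: H.
Qed.

Lemma carry_free_length_finite n (s : 'cV[R]_n) :
  (carry_free_length p s < +oo)%E ->
  exists l : nat, [/\ carry_free_length p s = l%:R%:E, carry_free_upto p s l &
    (p <= \sum_(j < n) digit p (s j 0%R) l.+1)%N].
Proof.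
move=> fin.
have p0 : (0 < p)%N by exact: ltnW.
have ex_ne : exists e, ~~ `[< carry_free_upto p s e >].
  apply: contrapT => noe; move: fin; have -> : carry_free_length p s = +oo%E.
    apply/carry_free_length_pinfty => e; apply: contrapT => ne; apply: noe.
    by exists e; apply/asboolPn.
  by rewrite ltxx.
have [e0 /asboolPn ne0 mine0] := ex_minnP ex_ne.
have cf d : (d < e0)%N -> carry_free_upto p s d.
  move=> de; apply: contrapT => nd.
  by have := mine0 d (introT (asboolPn _) nd); rewrite leqNgt de.
(* All digits at place 0 are 0, so the first failure is at some place [l.+1], and [l] is the
   supremum. *)
case: e0 => [|l] in ne0 mine0 cf *.
  exfalso; apply: ne0 => d; rewrite leqn0 => /eqP ->.
  by rewrite big1// => j _; exact: digit_at0.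
exists l; split; first last.
- rewrite leqNgt; apply/negP => H; apply: ne0 => d.
  rewrite leq_eqVlt => /orP[/eqP ->|dl]; first by rewrite -ltnS prednK.
  exact: (cf d).
- exact: cf.
apply/eqP; rewrite eq_le; apply/andP; split.
  apply: ge_ereal_sup => _ [d /= sd <-]; rewrite lee_fin ler_nat.
  rewrite leqNgt; apply/negP => ld; apply: ne0 => c cl; apply: sd.
  exact: leq_trans cl ld.
by apply: ereal_sup_ubound; exists l => //; exact: cf.
Qed.

End Digits.

(** Serves to lower the digits at the first carry until their sum is p - 1. *)
Lemma split_sum n (d : 'I_n -> nat) r : (r <= \sum_(j < n) d j)%N ->
  exists c : 'I_n -> nat, (forall j, c j <= d j)%N /\ (\sum_(j < n) c j)%N = r.
Proof.
elim: r => [|r IH] rd; first by exists (fun=> 0%N); rewrite big1.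
have [c [cd cr]] := IH (ltnW rd).
have [j cj] : exists j, (c j < d j)%N.
  apply/existsP; rewrite -[X in is_true X]negbK; apply/negP => /existsPn H.
  move: rd; rewrite -cr ltnNge => /negP; apply; apply: leq_sum => j _.
  by rewrite leqNgt.
exists (fun i => c i + (i == j))%N; split=> [i|].
  by have [->|_] := eqVneq; [rewrite addn1|rewrite addn0].
rewrite big_split /= cr [X in (_ + X)%N](bigD1 j)//= eqxx big1 ?addn1//.
by move=> i /negPf ->.
Qed.

(** * The splitting polytope *)

(** With [c] the slacks of constraints at a point and [b] the rates at which a direction consumes
    them, a small step respects all constraints. *)
Lemma ex_small_scale (R : realFieldType) (I : finType) (b c : I -> R) :
  (forall i, 0 <= c i) -> (forall i, c i = 0 -> b i = 0) ->
  exists2 eps, 0 < eps & forall i, eps * b i <= c i.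
Proof.
move=> c0 bc.
have S0 : 0 < 1 + \sum_i `|b i| / c i.
  by rewrite ltr_pwDl// sumr_ge0// => i _; rewrite divr_ge0.
exists (1 + \sum_i `|b i| / c i)^-1 => [|i]; first by rewrite invr_gt0.
have [ci|ci] := eqVneq (c i) 0; first by rewrite (bc i ci) mulr0.
have cp : 0 < c i by rewrite lt_neqAle eq_sym ci c0.
rewrite mulrC ler_pdivrMr//; apply: le_trans (ler_norm _) _.
rewrite mulrC -ler_pdivrMr// (bigD1 i)//= addrCA lerDl addr_ge0//.
by rewrite sumr_ge0// => j _; rewrite divr_ge0.
Qed.

Section SplittingPolytope.
Variables (R : realType) (m n : nat) (a : 'I_n -> mpoly.multinom m).
Hypothesis a_neq0 : forall j, a j <> @mpoly.mnm0 m.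

Lemma splitting_polytopeE (s : 'cV[R]_n) : splitting_polytope R a s <->
  (forall j, 0 <= s j 0) /\ forall i, \sum_(j < n) (a j i)%:R * s j 0 <= 1.
Proof.
have E i : (exponent_matrix R a *m s) i 0 = \sum_(j < n) (a j i)%:R * s j 0.
  by rewrite mxE; apply: eq_bigr => j _; rewrite mxE.
by split=> -[s0 s1]; split=> // i; have := s1 i; rewrite E.
Qed.

Lemma splitting_polytope_itv (s : 'cV[R]_n) j : splitting_polytope R a s ->
  0 <= s j 0 <= 1.
Proof.
move=> /splitting_polytopeE[s0 s1]; rewrite s0/=.
have [i ai] : exists i, a j i != 0%N.
  apply/existsP; rewrite -[X in is_true X]negbK; apply/negP => /existsPn H.
  apply: (a_neq0 (j := j)); apply/mpoly.mnmP => i; rewrite mpoly.mnm0E.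
  by apply/eqP; have := H i; rewrite negbK.
apply: le_trans (s1 i); rewrite (bigD1 j)//= ler_wpDr//.
  by apply: sumr_ge0 => l _; rewrite mulr_ge0.
by rewrite -[X in X <= _]mul1r ler_wpM2r// ler1n lt0n.
Qed.

Lemma splitting_polytope_scale (k : 'I_n -> nat) q : (0 < q)%N ->
  (forall i, \sum_(j < n) a j i * k j <= q)%N ->
  splitting_polytope R a (\col_j ((k j)%:R / q%:R)).
Proof.
move=> q0 kq; have q0' : 0 < q%:R :> R by rewrite ltr0n.
apply/splitting_polytopeE; split=> [j|i]; first by rewrite mxE divr_ge0.
under eq_bigr do rewrite mxE mulrA -natrM.
by rewrite -mulr_suml -natr_sum ler_pdivrMr// mul1r ler_nat.
Qed.

Lemma coord_sum_scale (k : 'I_n -> nat) q :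
  coord_sum (\col_j ((k j)%:R / q%:R) : 'cV[R]_n) = (\sum_(j < n) k j)%:R / q%:R.
Proof.
rewrite /coord_sum natr_sum mulr_suml.
by apply: eq_bigr => j _; rewrite mxE.
Qed.

Variable eta : 'cV[R]_n.
Hypothesis eta_max : maximal_point (splitting_polytope R a) eta.

Lemma scale_coord_sum_le (k : 'I_n -> nat) q : (0 < q)%N ->
  (forall i, \sum_(j < n) a j i * k j <= q)%N ->
  (\sum_(j < n) k j)%:R <= q%:R * coord_sum eta.
Proof.
move=> q0 kq; have q0' : 0 < q%:R :> R by rewrite ltr0n.
have := proj2 eta_max _ (splitting_polytope_scale q0 kq).
by rewrite coord_sum_scale ler_pdivrMr// mulrC.
Qed.

(** A non-zero term in row i has [k j] non-zero, hence below q eta_j, which makes the row strictly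
    smaller than q times that of [eta]. Strictness is what keeps the monomial outside the q-th
    Frobenius power. *)
Lemma weight_lt (k : 'I_n -> nat) q : (0 < q)%N ->
  (forall j, k j = 0%N \/ (k j)%:R < q%:R * eta j 0) ->
  forall i, (\sum_(j < n) a j i * k j < q)%N.
Proof.
move=> q0 kq i; have q0' : 0 < q%:R :> R by rewrite ltr0n.
have [/splitting_polytopeE[eta0 eta1] _] := eta_max.
have kle j : (a j i * k j)%:R <= q%:R * ((a j i)%:R * eta j 0).
  rewrite natrM mulrCA ler_wpM2l//.
  by case: (kq j) => [->|/ltW//]; apply: mulr_ge0 => //; exact: ltW.
have etaq : \sum_(j < n) q%:R * ((a j i)%:R * eta j 0) <= q%:R.
  by rewrite -mulr_sumr -[X in _ <= X]mulr1 ler_wpM2l// ltW.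
have [/existsP[j0 ak]|/existsPn nok] := boolP [exists j, a j i * k j != 0]%N; last first.
  by rewrite big1// => j _; apply/eqP; have := nok j; rewrite negbK.
rewrite -(ltr_nat R); apply: lt_le_trans etaq.
rewrite natr_sum (bigD1 j0)//= [ltRHS](bigD1 j0)//= ltr_leD//; last first.
  by apply: ler_sum => j _; exact: kle.
move: ak; rewrite muln_eq0 negb_or => /andP[a0 k0].
rewrite natrM mulrCA ltr_pM2l ?ltr0n ?lt0n//.
by case: (kq j0) => // /eqP; rewrite (negPf k0).
Qed.

Hypothesis eta_unique :
  forall s, maximal_point (splitting_polytope R a) s -> s = eta.

Lemma maximal_point_eq (s : 'cV[R]_n) : splitting_polytope R a s ->
  coord_sum eta <= coord_sum s -> s = eta.
Proof.
move=> sP se; apply: eta_unique; split=> // t /(proj2 eta_max) te.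
exact: le_trans te se.
Qed.

Lemma weight_inj (k k' : 'I_n -> nat) q : (0 < q)%N ->
  (forall j, (k j)%:R <= q%:R * eta j 0) ->
  (\sum_(j < n) k' j = \sum_(j < n) k j)%N ->
  (forall i, \sum_(j < n) a j i * k' j = \sum_(j < n) a j i * k j)%N -> k' =1 k.
Proof.
move=> q0 kq dk wk; have q0' : 0 < q%:R :> R by rewrite ltr0n.
have [/splitting_polytopeE[eta0 eta1] _] := eta_max.
pose s : 'cV[R]_n := \col_j (eta j 0 + ((k' j)%:R - (k j)%:R) / q%:R).
have sE : s = eta.
  apply: maximal_point_eq.
    apply/splitting_polytopeE; split=> [j|i].
      rewrite mxE -[X in X + _](mulfK (lt0r_neq0 q0')) -mulrDl divr_ge0 ?(ltW q0')//.
      by have := kq j; have := ler0n R (k' j); rewrite mulrC; lra.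
    under eq_bigr do rewrite mxE mulrDr mulrA mulrBr -!natrM.
    by rewrite big_split/= -mulr_suml sumrB -!natr_sum wk subrr mul0r addr0.
  rewrite /coord_sum; under [leRHS]eq_bigr do rewrite mxE.
  by rewrite big_split/= -mulr_suml sumrB -!natr_sum dk subrr mul0r addr0.
move=> j; have /colP/(_ j)/eqP := sE; rewrite mxE -subr_eq0 addrAC subrr add0r.
rewrite mulf_eq0 invr_eq0 (negPf (lt0r_neq0 q0')) orbF subr_eq0 eqr_nat.
by move/eqP.
Qed.

(** [eta] is a vertex: small steps along [v] and its opposite respect all constraints, and one of
    the two does not lower the coordinate sum, so uniqueness forces it to vanish. *)
Lemma tight_direction_eq0 (v : 'I_n -> R) :
  (forall j, eta j 0 = 0 -> v j = 0) ->
  (forall i, \sum_(j < n) (a j i)%:R * eta j 0 = 1 ->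
     \sum_(j < n) (a j i)%:R * v j = 0) ->
  forall j, v j = 0.
Proof.
wlog v_ge0 : v / 0 <= \sum_(j < n) v j => [H|].
  have [v0|v0] := leP 0 (\sum_(j < n) v j); first exact: H.
  move=> v1 v2 j; apply/eqP; rewrite -oppr_eq0; apply/eqP; apply: (H (fun j => - v j)).
  - by rewrite sumrN oppr_ge0 ltW.
  - by move=> l /v1 ->; rewrite oppr0.
  - by move=> i /v2 vi; under eq_bigr do rewrite mulrN; rewrite sumrN vi oppr0.
move=> v1 v2.
have [/splitting_polytopeE[eta0 eta1] _] := eta_max.
(* [c] collects the slacks at [eta] of the n + m constraints, [b] their rates of decrease along
   [v]. *)
pose c (x : 'I_n + 'I_m) : R := match x with
  | inl j => eta j 0 | inr i => 1 - \sum_(j < n) (a j i)%:R * eta j 0 end.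
pose b (x : 'I_n + 'I_m) : R := match x with
  | inl j => - v j | inr i => \sum_(j < n) (a j i)%:R * v j end.
have [eps eps0 epsP] : exists2 eps, 0 < eps & forall x, eps * b x <= c x.
  apply: ex_small_scale => [[j|i]|[j|i]] /=; rewrite ?subr_ge0//.
    by move/v1 ->; rewrite oppr0.
  by move=> /eqP; rewrite subr_eq0 => /eqP/esym/v2.
have sE : \col_j (eta j 0 + eps * v j) = eta.
  apply: maximal_point_eq.
    apply/splitting_polytopeE; split=> [j|i].
      by rewrite mxE; have := epsP (inl j); rewrite /= mulrN; lra.
    under eq_bigr do rewrite mxE mulrDr mulrCA.
    by rewrite big_split/= -mulr_sumr; have := epsP (inr i) => /=; lra.
  rewrite /coord_sum; under [leRHS]eq_bigr do rewrite mxE.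
  by rewrite big_split/= lerDl -mulr_sumr mulr_ge0// ltW.
move=> j; have /colP/(_ j)/eqP := sE; rewrite mxE -subr_eq0 addrAC subrr add0r.
by rewrite mulf_eq0 (negPf (lt0r_neq0 eps0)) => /eqP.
Qed.

(* eta is the only solution of the linear system, with rational coefficients,
   of the constraints of the polytope that are tight at eta. *)
Lemma unique_maximal_point_rat j : exists q : rat, eta j 0 = ratr q.
Proof.
(* The columns of [B1] stand for the coordinates where [eta] vanishes, those of [B2] for the rows
   tight at [eta]; all other columns are 0. *)
pose B1 : 'M[rat]_n := \matrix_(i, l) ((i == l) && (eta l 0 == 0))%:R.
pose tight i := \sum_(l < n) (a l i)%:R * eta l 0 == 1.
pose B2 : 'M[rat]_(n, m) := \matrix_(l, i) if tight i then (a l i)%:R else 0.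
pose c2 : 'rV[rat]_m := \row_i (tight i)%:R.
pose toR k l (M : 'M[rat]_(k, l)) : 'M[R]_(k, l) := map_mx ratr M.
have mulB1 (w : 'rV[R]_n) l : (w *m toR _ _ B1) 0 l = w 0 l *+ (eta l 0 == 0).
  rewrite mxE (bigD1 l)//= big1 ?addr0 => [|i il]; last first.
    by rewrite !mxE (negPf il) rmorph0 mulr0.
  by rewrite !mxE eqxx /= ratr_nat mulr_natr.
have mulB2 (w : 'rV[R]_n) i : (w *m toR _ _ B2) 0 i =
    (\sum_(l < n) (a l i)%:R * w 0 l) *+ (tight i).
  rewrite mxE; case: (boolP (tight i)) => ti; last first.
    by rewrite big1// => l _; rewrite !mxE (negPf ti) rmorph0 mulr0.
  by apply: eq_bigr => l _; rewrite !mxE ti ratr_nat mulrC.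
have etaB : eta^T *m toR _ _ (row_mx B1 B2) = toR _ _ (row_mx 0 c2).
  rewrite /toR !map_row_mx mul_mx_row; congr row_mx; apply/rowP => l.
    rewrite mulB1 !mxE rmorph0.
    by have [->|_] := eqVneq (eta l 0) 0; rewrite ?mul0rn ?mulr0n.
  rewrite mulB2 !mxE ratr_nat; under eq_bigr do rewrite mxE.
  by rewrite /tight; case: eqP => [->|_]; rewrite ?mulr1n ?mulr0n.
(* Inclusion of row spaces is insensitive to field extension, so the real solution [eta] yields a
   rational solution [D]. *)
have /submxP[D cD] : (row_mx 0 c2 <= row_mx B1 B2)%MS.
  by rewrite -(map_submx (@ratr R)); apply/submxP; exists eta^T.
exists (D 0 j); apply/eqP; rewrite -subr_eq0; apply/eqP.
pose w : 'rV[R]_n := eta^T - toR _ _ D.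
have -> : eta j 0 - ratr (D 0 j) = w 0 j by rewrite !mxE.
have wB : w *m toR _ _ (row_mx B1 B2) = 0.
  by rewrite mulmxBl etaB cD /toR map_mxM subrr.
have {wB} [w1 w2] : w *m toR _ _ B1 = 0 /\ w *m toR _ _ B2 = 0.
  move: wB; rewrite /toR map_row_mx mul_mx_row -row_mx0 => /eq_row_mx.
  by [].
apply: (tight_direction_eq0 (v := fun l => w 0 l)) => [l el|i ti].
  by have := mulB1 w l; rewrite w1 el eqxx mulr1n mxE.
by have := mulB2 w i; rewrite w2 /tight ti eqxx mulr1n mxE.
Qed.

End SplittingPolytope.

(** * F-pure thresholds *)

Section Thresholds.
Variables (R : realType) (K : fieldType) (p m n : nat).
Variables (a : 'I_n -> mpoly.multinom m) (f : mpoly.mpoly m K) (eta : 'cV[R]_n).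
Hypotheses (charK : p \in [pchar K]) (a_inj : injective a).
Hypotheses (a_neq0 : forall j, a j <> @mpoly.mnm0 m).
Hypothesis supp_f : mpoly.msupp f =i codom a.
Hypothesis eta_max : maximal_point (splitting_polytope R a) eta.
Hypothesis eta_unique :
  forall s, maximal_point (splitting_polytope R a) s -> s = eta.

Local Notation nu q := (fpt_nu (ideal_gen [set f]) q).
Local Notation trunc j N := (digit_num p (digit p (eta j 0)) N).

Let p_gt1 : (1 < p)%N.
Proof. exact: prime_gt1 (pcharf_prime charK). Qed.

Let pX_gt0 N : (0 < p ^ N)%N.
Proof. by rewrite expn_gt0 ltnW. Qed.

Let pX_gt0R N : 0 < p%:R ^+ N :> R.
Proof. by rewrite -natrX ltr0n. Qed.

Let eta_itv j : 0 <= eta j 0 <= 1.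
Proof. by apply: (splitting_polytope_itv a_neq0); case: eta_max. Qed.

Lemma fpt_nu_ratio_le I N : (forall y, I y -> Polynomials.monomial_ideal K a y) ->
  (fpt_nu I (p ^ N))%:R / p%:R ^+ N <= coord_sum eta.
Proof.
move=> IM; have [k [<- kq]] := Polynomials.fpt_nu_expo a_neq0 IM (pX_gt0 N).
rewrite ler_pdivrMr// mulrC -natrX.
by apply: (scale_coord_sum_le eta_max) => // i; exact: ltnW.
Qed.

Lemma trunc_sum_ge N :
  coord_sum eta - n%:R / p%:R ^+ N <= (\sum_(j < n) trunc j N)%:R / p%:R ^+ N.
Proof.
rewrite lerBlDr -mulrDl ler_pdivlMr// -natrD /coord_sum.
have -> : (\sum_(j < n) trunc j N + n = \sum_(j < n) (trunc j N).+1)%N.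
  by under [RHS]eq_bigr do rewrite -addn1; rewrite big_split/= sum1_card card_ord.
rewrite natr_sum mulr_suml.
by apply: ler_sum => j _; rewrite mulrC; exact: digit_num_ge.
Qed.

Lemma cvg_coord_sum_error :
  (fun N => coord_sum eta - n%:R / p%:R ^+ N : R) @ \oo --> coord_sum eta.
Proof.
rewrite -[X in _ --> X]subr0 -[X in _ - X](mulr0 n%:R).
by apply: cvgB; [exact: cvg_cst|apply: cvgMr; exact: cvg_invX_base].
Qed.

(** The truncations of [eta] give admissible exponents by [weight_lt] and approach [eta], which
    squeezes the quotients against their upper bound |eta|. *)
Lemma fpt_monomialsE : fpt_monomials R p K a = coord_sum eta.
Proof.
apply: cvg_lim; first exact: Rhausdorff.
apply: (squeeze_cvgr _ cvg_coord_sum_error (cvg_cst (coord_sum eta))).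
near=> N; rewrite natrX fpt_nu_ratio_le// andbT.
apply: le_trans (trunc_sum_ge N) _; rewrite ler_pM2r ?invr_gt0// ler_nat.
apply: Polynomials.le_fpt_nu_monomials => //.
apply: (weight_lt eta_max) => // j; rewrite natrX; exact: digit_num_lt.
Unshelve. all: by end_near. Qed.

(** The left inequality yields the lower estimates of fpt(f); the right one serves in [fpt_poly_le]
    and in the converse. *)
Lemma fpt_poly_bounds N :
  (nu (p ^ N))%:R / p%:R ^+ N <= fpt_poly R p f <= (nu (p ^ N)).+1%:R / p%:R ^+ N.
Proof.
have step M : (p * nu (p ^ M) <= nu (p ^ M.+1) < p * (nu (p ^ M)).+1)%N.
  rewrite expnSr; exact: (Polynomials.fpt_nu_principal_mulp charK a_inj a_neq0 supp_f).
have [l [lc lb]] := base_approx_cvg R p_gt1 step.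
suff -> : fpt_poly R p f = l by [].
apply: cvg_lim; first exact: Rhausdorff.
rewrite (_ : (fun e => _) = (fun M => (nu (p ^ M))%:R / p%:R ^+ M))//.
by apply/funext => M; rewrite natrX.
Qed.

Lemma fpt_poly_le : fpt_poly R p f <= coord_sum eta.
Proof.
have c0 : (fun N => coord_sum eta + (p%:R ^+ N)^-1 : R) @ \oo --> coord_sum eta.
  rewrite -[X in _ --> X]addr0.
  by apply: cvgD; [exact: cvg_cst|exact: cvg_invX_base].
apply: (ler_cvg_to (cvg_cst _) c0).
near=> N; have /andP[_] := fpt_poly_bounds N.
move/le_trans; apply; rewrite -addn1 natrD mulrDl mul1r lerD2r.
by apply: fpt_nu_ratio_le; exact: Polynomials.principal_sub_monomial_ideal.
Unshelve. all: by end_near. Qed.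

(** The common source of the lower bounds: [k] is the truncation of [eta] when nothing carries, and
    a modification of it otherwise. *)
Lemma no_carry_le_fpt_nu (k : 'I_n -> nat) N : no_carry p k ->
  (forall j, k j <= trunc j N)%N -> (\sum_(j < n) k j <= nu (p ^ N))%N.
Proof.
move=> nck kt.
have kq j : k j = 0%N \/ (k j)%:R < (p ^ N)%:R * eta j 0.
  have [t0|tlt] := digit_num_lt p_gt1 N (eta_itv j).
    by left; apply/eqP; rewrite -leqn0 -t0.
  by right; rewrite natrX; apply: le_lt_trans tlt; rewrite ler_nat.
apply: (Polynomials.le_fpt_nu_principal charK a_inj a_neq0 supp_f) => //.
  exact: (weight_lt eta_max).
move=> k'; apply: (weight_inj eta_max eta_unique (pX_gt0 N)) => j.
case: (kq j) => [->|/ltW//].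
by apply: mulr_ge0 => //; case/andP: (eta_itv j).
Qed.

Lemma fpt_poly_eq_of_carry_free : carry_free_length p eta = +oo%E ->
  fpt_poly R p f = fpt_monomials R p K a.
Proof.
move=> /carry_free_length_pinfty cf; rewrite fpt_monomialsE.
apply/eqP; rewrite eq_le fpt_poly_le/=.
apply: (ler_cvg_to cvg_coord_sum_error (cvg_cst _)).
near=> N; apply: le_trans (trunc_sum_ge N) _.
have /andP[+ _] := fpt_poly_bounds N; apply: le_trans.
rewrite ler_pM2r ?invr_gt0// ler_nat; apply: no_carry_le_fpt_nu => //.
by apply/(carry_free_uptoE p_gt1).
Unshelve. all: by end_near. Qed.

(* Past the first carry, digits with sum exactly p - 1 are chosen: below those
   of eta in position l + 1, and all equal to p - 1 in one column afterwards.
   That column has a digit to spare in position l + 1. *)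
Lemma fpt_poly_ge_truncation l : carry_free_upto p eta l ->
  (p <= \sum_(j < n) digit p (eta j 0%R) l.+1)%N ->
  \sum_(j < n) truncation p (eta j 0) l + 1 / p%:R ^+ l <= fpt_poly R p f.
Proof.
move=> /(carry_free_uptoE p_gt1) ncl carry.
have p0 : (0 < p)%N by exact: ltnW.
have [c [cd csum]] := split_sum (leq_trans (leq_pred p) carry).
have [j0 cj0] : exists j, (c j < digit p (eta j 0%R) l.+1)%N.
  apply/existsP; rewrite -[X in is_true X]negbK; apply/negP => /existsPn H.
  have : (\sum_(j < n) digit p (eta j 0%R) l.+1 <= \sum_(j < n) c j)%N.
    by apply: leq_sum => j _; rewrite leqNgt.
  by rewrite csum leqNgt -ltnS prednK// ltnS carry.
pose k := fix k (s : nat) (j : 'I_n) : nat :=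
  if s is s'.+1 then (p * k s' j + (p.-1) * (j == j0))%N else (p * trunc j l + c j)%N.
have digit_lt (b : bool) : (p.-1 * b < p)%N.
  by case: b; rewrite ?muln1 ?muln0// prednK.
have dsum : (\sum_(j < n) p.-1 * (j == j0) = p.-1)%N.
  by rewrite -big_distrr (bigD1 j0)//= eqxx big1 ?addn0 ?muln1// => j /negPf ->.
have nck s : no_carry p (k s).
  elim: s => [|s IH] /=; apply/no_carry_digit => //.
  - move=> j; apply: leq_ltn_trans (cd j) _.
    by rewrite -[X in (_ < X)%N](prednK p0) ltnS digit_le.
  - by rewrite csum prednK.
  - by rewrite dsum prednK.
(* Repeating the digit sum p - 1 makes the total tend to that of the truncations plus 1 / p ^ l, one
   unit of the last place short of it at each stage. *)
have ksum s : ((\sum_(j < n) k s j).+1 = p ^ s.+1 * (\sum_(j < n) trunc j l).+1)%N.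
  elim: s => [|s IH] /=.
    by rewrite big_split/= csum -big_distrr/= expn1 mulnS -addnS prednK// addnC.
  by rewrite big_split/= dsum -big_distrr/= -addnS prednK// -mulnSr IH mulnA -expnS.
have kt s j : (k s j + (j == j0) <= trunc j (l.+1 + s))%N.
  elim: s => [|s IH] /=.
    rewrite addn0 /= -addnA leq_add2l.
    by have [->|_] := eqVneq j j0; rewrite ?addn1 ?addn0.
  rewrite addnS /= -addnA; apply: leq_trans (leq_addr _ _).
  apply: leq_trans (leq_mul (leqnn p) IH); rewrite mulnDr leq_add2l.
  by case: (j == j0); rewrite ?muln1 ?muln0 ?addn1 ?prednK.
have tE : \sum_(j < n) truncation p (eta j 0) l = (\sum_(j < n) trunc j l)%:R / p%:R ^+ l.
  by rewrite natr_sum mulr_suml; apply: eq_bigr => j _; rewrite -digit_sum_num.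
rewrite tE -mulrDl natr1; set T := (\sum_(j < n) trunc j l)%N in ksum *.
have bound N : (l < N)%N -> T.+1%:R / p%:R ^+ l - (p%:R ^+ N)^-1 <= fpt_poly R p f.
  move=> lN; pose s := (N - l.+1)%N; have NE : N = (l.+1 + s)%N by rewrite subnKC.
  have /andP[+ _] := fpt_poly_bounds N; apply: le_trans.
  have -> : T.+1%:R / p%:R ^+ l = (\sum_(j < n) k s j).+1%:R / p%:R ^+ N :> R.
    rewrite ksum natrM natrX NE addSnnS addnC exprD invfM mulrACA divff ?mul1r//.
    by rewrite gt_eqF.
  rewrite -natr1 mulrDl mul1r addrK ler_pM2r ?invr_gt0// ler_nat.
  apply: no_carry_le_fpt_nu => // j.
  by rewrite NE; apply: leq_trans (kt s j); rewrite leq_addr.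
have c0 : (fun N => T.+1%:R / p%:R ^+ l - (p%:R ^+ N)^-1 : R) @ \oo -->
    (T.+1%:R / p%:R ^+ l : R).
  rewrite -[X in _ --> X]subr0.
  by apply: cvgB; [exact: cvg_cst|exact: cvg_invX_base].
apply: (ler_cvg_to c0 (cvg_cst _)); near=> N; apply: bound.
by near: N; exact: nbhs_infty_gt.
Unshelve. all: by end_near. Qed.

Lemma periodic_digits (e0 : nat) :
  (forall j (q : rat), eta j 0 = ratr q -> ~~ (p %| `|denq q|)%N) ->
  exists2 e, (e0 <= e)%N &
    forall j, (trunc j e)%:R = (p ^ e).-1%:R * eta j 0.
Proof.
move=> den; have /choice[x xE] := unique_maximal_point_rat eta_max eta_unique.
pose D := (\prod_(j < n) `|denq (x j)|)%N.
have D0 : (0 < D)%N by apply: prodn_gt0 => j; rewrite absz_gt0 denq_neq0.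
have pD : coprime p D.
  rewrite prime_coprime ?(pcharf_prime charK)//.
  rewrite /D; elim/big_ind: _ => [|y z py pz|j _].
  - by rewrite dvdn1; apply/eqP => p1; have := p_gt1; rewrite p1.
  - by rewrite Euclid_dvdM ?(pcharf_prime charK)// negb_or py.
  - exact: den (xE j).
(* By Euler's theorem [D] divides p ^ e - 1 for every multiple e of [totient D]; the factor [e0]
   makes e large. *)
pose e := (totient D * e0)%N; exists e; first by rewrite leq_pmull// totient_gt0.
have De : (D %| (p ^ e).-1)%N.
  rewrite -subn1 -eqn_mod_dvd// /e expnM -modnXm Euler_exp_totient//.
  by rewrite modnXm exp1n.
move=> j; have dj : (`|denq (x j)| %| (p ^ e).-1)%N.
  by apply: dvdn_trans De; rewrite /D (bigD1 j)//= dvdn_mulr.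
have /andP[eta0 eta1] := eta_itv j.
have [k kE] : exists k : nat, k%:R = (p ^ e).-1%:R * eta j 0.
  exists (`|numq (x j)| * ((p ^ e).-1 %/ `|denq (x j)|))%N.
  have num0 : 0 <= numq (x j) by rewrite numq_ge0 -(ler0q R) -xE.
  have numE : (numq (x j))%:~R = `|numq (x j)|%:R :> R.
    by rewrite -[in LHS](gez0_abs num0) -pmulrn.
  have denE : (denq (x j))%:~R = `|denq (x j)|%:R :> R.
    by rewrite -[in LHS]absz_denq -pmulrn.
  rewrite -[in RHS](divnK dj) xE /ratr numE denE !natrM mulrACA divff ?mulr1.
    exact: mulrC.
  by rewrite pnatr_eq0 absz_eq0 denq_neq0.
have qE : (p ^ e).-1%:R = p%:R ^+ e - 1 :> R.
  by rewrite -natrX -[in RHS](prednK (pX_gt0 e)) -natr1 addrK.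
rewrite -kE; congr (_%:R); rewrite qE mulrBl mul1r in kE.
have := eta0; rewrite le_eqVlt => /orP[/eqP eta00|eta_gt0].
  rewrite -eta00 digit_num0//; move/eqP: kE; rewrite -eta00 mulr0 subr0.
  by rewrite pnatr_eq0 => /eqP.
have /(digit_num_bounds p_gt1 e)/andP[lo hi] : 0 < eta j 0 <= 1 by rewrite eta_gt0.
(* Since p ^ e eta_j = k + eta_j with 0 < eta_j <= 1, the integer [k] satisfies the bounds that
   determine the truncation. *)
apply/eqP; rewrite eqn_leq -ltnS -[(k <= _)%N]ltnS -!(ltr_nat R); apply/andP; split.
  by rewrite -natr1 kE; lra.
by apply: lt_le_trans hi; rewrite kE; lra.
Qed.

Lemma carry_free_of_fpt_poly_eq :
  (forall j (q : rat), eta j 0 = ratr q -> ~~ (p %| `|denq q|)%N) ->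
  fpt_poly R p f = fpt_monomials R p K a -> carry_free_length p eta = +oo%E.
Proof.
move=> den fptE; rewrite fpt_monomialsE in fptE.
apply/carry_free_length_pinfty => e0.
(* If e = 0 then [e0] is 0 as well, where nothing carries; otherwise p ^ e - 1 is positive and can
   be divided by. *)
have [[//|e] e0e tE] := periodic_digits e0 den.
  rewrite leqn0 in e0e; move: e0e => /eqP ->.
  exact/(carry_free_uptoE p_gt1)/no_carry0/ltnW.
suff : carry_free_upto p eta e.+1.
  by move=> H d de; apply: H; exact: leq_trans de e0e.
apply/(carry_free_uptoE p_gt1).
set q := (p ^ e.+1)%N in tE; have q1 : (0 < q.-1)%N.
  by rewrite -ltnS prednK ?pX_gt0// (leq_trans p_gt1)// /q expnS leq_pmulr.
have qE : q.-1%:R = p%:R ^+ e.+1 - 1 :> R.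
  by rewrite -natrX -/q -[in RHS](prednK (pX_gt0 e.+1 : (0 < q)%N)) -natr1 addrK.
have sumE : (\sum_(j < n) trunc j e.+1)%:R = q.-1%:R * coord_sum eta.
  by rewrite natr_sum mulr_sumr; apply: eq_bigr => j _; exact: tE.
have alpha0 : 0 <= coord_sum eta.
  by apply: sumr_ge0 => j _; case/andP: (eta_itv j).
have r_nu : (\sum_(j < n) trunc j e.+1 <= nu q)%N.
  (* If |eta| > 0, then (q - 1) |eta| < q |eta| <= nu(q) + 1, and the left side is an integer. *)
  have [alpha00|alpha_gt0] := eqVneq (coord_sum eta) 0.
    by move/eqP: sumE; rewrite alpha00 mulr0 pnatr_eq0 => /eqP ->.
  rewrite -ltnS -(ltr_nat R) sumE qE mulrBl mul1r.
  have /andP[_] := fpt_poly_bounds e.+1; rewrite fptE ler_pdivlMr// mulrC -/q.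
  apply: lt_le_trans; rewrite ltrBlDr ltrDl.
  by rewrite lt_neqAle eq_sym alpha_gt0.
have [k [ksum kq nck]] :=
  Polynomials.no_carry_of_le_fpt_nu charK a_inj a_neq0 supp_f (pX_gt0 e.+1) r_nu.
have kq' i : (\sum_(j < n) a j i * k j <= q.-1)%N by rewrite -ltnS prednK ?pX_gt0.
have q1R : 0 < q.-1%:R :> R by rewrite ltr0n.
(* Weights below q are at most q - 1, so dividing by q - 1 gives a point of the polytope, with
   coordinate sum |eta|. *)
have /colP kE : \col_j ((k j)%:R / q.-1%:R) = eta.
  apply: (maximal_point_eq eta_max eta_unique).
    exact: splitting_polytope_scale.
  by rewrite coord_sum_scale ksum sumE [_%:R * _]mulrC mulfK// gt_eqF.
apply: (eq_no_carry _ nck) => j; apply/eqP; rewrite -(eqr_nat R) tE -kE mxE.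
by rewrite mulrC divfK// gt_eqF.
Qed.

End Thresholds.

Theorem theorem4p2 (R : realType) (K : fieldType) (p m n : nat)
    (a : 'I_n -> mpoly.multinom m) (f : mpoly.mpoly m K) (eta : 'cV[R]_n)
    (charK : p \in [pchar K]) (finK : F_finite p K)
    (a_inj : injective a) (a_neq0 : forall j, a j <> @mpoly.mnm0 m)
    (supp_f : mpoly.msupp f =i codom a)
    (eta_max : maximal_point (splitting_polytope R a) eta)
    (eta_unique : forall s, maximal_point (splitting_polytope R a) s -> s = eta) :
  let L := carry_free_length p eta in
  [/\ L = +oo%E -> fpt_poly R p f = fpt_monomials R p K a,
      diagonal_position R a ->
        (forall j (q : rat), eta j 0 = ratr q -> ~~ (p %| `|denq q|)%N) ->
        fpt_poly R p f = fpt_monomials R p K a -> L = +oo%E &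
      (L < +oo)%E -> exists l : nat, L = l%:R%:E /\
        \sum_(j < n) truncation p (eta j 0) l + 1 / p%:R ^+ l
          <= fpt_poly R p f].
Proof.
have p_gt1 : (1 < p)%N by exact: prime_gt1 (pcharf_prime charK).
move=> L; split.
- exact: (fpt_poly_eq_of_carry_free charK a_inj a_neq0 supp_f eta_max eta_unique).
- move=> _.
  exact: (carry_free_of_fpt_poly_eq charK a_inj a_neq0 supp_f eta_max eta_unique).
- move=> /(carry_free_length_finite p_gt1)[l [LE cf carry]]; exists l; split=> //.
  exact: (fpt_poly_ge_truncation charK a_inj a_neq0 supp_f eta_max eta_unique).
Qed.
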